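(* Fix integers $g\ge 2$ and $r\ge 3$. Let $M$ be a simple matroid of rank $r$ with $|E(M)|=r+g\binom{r}{2}$ such that $|F|\le h+g\binom{h}{2}$ for every flat $F$ of rank $h=r(F)$. Call a rank-$h$ flat $F$ large if $|F|=h+g\binom{h}{2}$. Assume that whenever $2<h<r$ and $F$ is a rank-$h$ flat that is not large, $|F|\le h+g\binom{h-1}{2}$. Then: (a) $M$ has at most $r$ large hyperplanes; (b) if $M$ has $r$ large hyperplanes, then $M$ has a basis $B$ such that $\mathrm{cl}(X)$ is large for every $X\subseteq B$; (c) if $M$ has $r$ large hyperplanes, then $M$ has at most $\binom{r}{3}g^2$ three-point lines, and if $M$ has exactly $\binom{r}{3}g^2$ three-point lines then $M$ is a rank-$r$ Dowling geometry based on a group (or on a quasigroup if $r=3$) of order $g$.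
   Context: All matroids are finite. Dowling geometries. For a finite group $G$ (written multiplicatively) and $r\ge 3$, the Dowling geometry $Q_r(G)$ has ground set $\{b_1,\ldots,b_r\}\cup\{a_{(i,j)}: a\in G,\ 1\le i<j\le r\}$ (so it has $r+|G|\binom r2$ elements), with the convention $a_{(i,j)}=(a^{-1})_{(j,i)}$ for $i>j$. Its connected flats of size greater than one are: for $I\subseteq[r]$ with $|I|\ge2$, the large flat $\{b_i:i\in I\}\cup\{a_{(i,j)}: a\in G,\ \{i,j\}\subseteq I\}$, of rank $|I|$ and support $I$; and for $J=\{j_1<\cdots<j_t\}\subseteq[r]$ with $t\ge3$ and $a_2,\ldots,a_t\in G$, the small flat $\{(a_h)_{(j_1,j_h)}:2\le h\le t\}\cup\{(a_h^{-1}a_i)_{(j_h,j_i)}:2\le h<i\le t\}$, of rank $t-1$ and support $J$. $Q_r(G)$ is the simple matroid whose cyclic flats are exactly the unions of at most one large flat and any number of small flats with pairwise disjoint supports, the rank of such a union being the sum of the ranks of its parts. For $r=3$ and a quasigroup $G$ (a finite set with a binary operation such that $ax=b$ and $ya=b$ have unique solutions for all $a,b$), $Q_3(G)$ is the simple rank-3 matroid on $\{b_1,b_2,b_3\}\cup\{a_{(i,j)}:a\in G,1\le i<j\le 3\}$ whose lines with at least three points are exactly the three sets $\{b_i,b_j\}\cup\{a_{(i,j)}:a\in G\}$ and the sets $\{a_{(1,2)},a'_{(2,3)},(aa')_{(1,3)}\}$ for $a,a'\in G$. *)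

(* Defs.v *)
From mathcomp Require Import all_boot all_fingroup.

Set Implicit Arguments.
Unset Strict Implicit.
Unset Printing Implicit Defensive.

(* The ground set of a matroid is the whole finite type E. *)
Record matroid (E : finType) := Matroid {
  rk : {set E} -> nat;
  rk_le_card : forall X, rk X <= #|X|;
  rk_mono : forall X Y : {set E}, X \subset Y -> rk X <= rk Y;
  rk_submod : forall X Y, rk (X :|: Y) + rk (X :&: Y) <= rk X + rk Y
}.

Section MatroidNotions.
Variables (E : finType) (M : matroid E).
Implicit Types X F C B : {set E}.

Definition mrank : nat := rk M [set: E].

Definition indep X : bool := rk M X == #|X|.

Definition basis B : bool := maxset indep B.

Definition circuit C : bool := minset [pred X | ~~ indep X] C.

(* No loops (one-element circuits) and no parallel pairs (two-element ones). *)
Definition simple_matroid : bool := [forall C, circuit C ==> (2 < #|C|)].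

Definition cl X : {set E} := [set x | rk M (x |: X) == rk M X].

Definition flat F : bool := cl F == F.

Definition hyperplane F : bool := flat F && ((rk M F).+1 == mrank).

Definition line F : bool := flat F && (rk M F == 2).

(* Flats that are unions of circuits. *)
Definition cyclic_flat F : bool :=
  flat F && (F == cover [set C | circuit C & C \subset F]).

Definition large (g : nat) F : bool :=
  flat F && (#|F| == rk M F + g * 'C(rk M F, 2)).

Definition large_hyperplanes (g : nat) : {set {set E}} :=
  [set H | hyperplane H & large g H].

Definition three_point_lines : {set {set E}} :=
  [set L | line L & #|L| == 3].

End MatroidNotions.

Definition isomorphic (E E' : finType) (M : matroid E) (M' : matroid E') :
    Prop :=
  exists2 f : E -> E', bijective f & forall X : {set E}, rk M' (f @: X) = rk M X.

(* inl i stands for b_i, and inr (a, (i, j)) for a_(i,j) with i < j.  Indices  *)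
(* run over {0, .., r - 1}.  The convention a_(i,j) = (a^-1)_(j,i) for i > j   *)
(* is not needed: below, elements are only ever described with i < j.          *)
Definition dowling_pt (r : nat) (G : finType) : finType :=
  ('I_r + G * {ij : 'I_r * 'I_r | ij.1 < ij.2})%type.

Definition pt_a (r : nat) (G : finType) (a : G) (i j : 'I_r) (ltij : i < j) :
    dowling_pt r G :=
  inr (a, exist (fun ij : 'I_r * 'I_r => ij.1 < ij.2) (i, j) ltij).

Definition large_flat (r : nat) (G : finType) (I : {set 'I_r}) :
    {set dowling_pt r G} :=
  [set x : dowling_pt r G |
    match x with
    | inl i => i \in I
    | inr (_, ij) => ((val ij).1 \in I) && ((val ij).2 \in I)
    end].

(* For J = {j_1 < .. < j_t}, the elements a_2, .., a_t of the group are        *)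
(* a j_2, .., a j_t; the values of a at j_1 and outside J play no role.  The   *)
(* test in the conditional says that i = j_1.                                  *)
Definition small_flat (r : nat) (G : finGroupType) (J : {set 'I_r})
    (a : 'I_r -> G) : {set dowling_pt r G} :=
  [set x : dowling_pt r G |
    match x with
    | inl _ => false
    | inr (c, ij) =>
        let: (i, j) := val ij in
        [&& i \in J, j \in J &
            c == if [forall k in J, i <= k] then a j else ((a i)^-1 * a j)%g]
    end].

(* X is a union of at most one large flat (of support I; I = set0 when there   *)
(* is none) and of small flats, one for each support J in P, all supports      *)
(* being pairwise disjoint; k is the sum of the ranks of the parts.            *)
Definition dowling_union (r : nat) (G : finGroupType)
    (X : {set dowling_pt r G}) (k : nat) : Prop :=
  exists (I : {set 'I_r}) (P : {set {set 'I_r}}) (a : {set 'I_r} -> 'I_r -> G),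
    [/\ I = set0 \/ 2 <= #|I|,
        trivIset P,
        (forall J, J \in P -> 3 <= #|J| /\ [disjoint I & J]),
        X = large_flat G I :|: \bigcup_(J in P) small_flat J (a J)
      & k = #|I| + \sum_(J in P) (#|J| - 1)].

Definition is_dowling (r : nat) (G : finGroupType)
    (Q : matroid (dowling_pt r G)) : Prop :=
  simple_matroid Q /\
  forall (X : {set dowling_pt r G}) (k : nat),
    (cyclic_flat Q X /\ rk Q X = k) <-> dowling_union X k.

Definition quasigroup (G : finType) (op : G -> G -> G) : Prop :=
  (forall a b, exists! x, op a x = b) /\ (forall a b, exists! y, op y a = b).

Definition ord3_1 : 'I_3 := @Ordinal 3 0 isT.
Definition ord3_2 : 'I_3 := @Ordinal 3 1 isT.
Definition ord3_3 : 'I_3 := @Ordinal 3 2 isT.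

Definition is_dowling3 (G : finType) (op : G -> G -> G)
    (Q : matroid (dowling_pt 3 G)) : Prop :=
  [/\ simple_matroid Q,
      mrank Q = 3
    & forall L : {set dowling_pt 3 G},
        (line Q L /\ 3 <= #|L|) <->
        (exists i j : 'I_3, i < j /\ L = large_flat G [set i; j]) \/
        (exists a a' : G,
          L = [set @pt_a 3 G a ord3_1 ord3_2 isT; @pt_a 3 G a' ord3_2 ord3_3 isT;
                   @pt_a 3 G (op a a') ord3_1 ord3_3 isT])].

Definition dowling_geometry (r g : nat) (E : finType) (M : matroid E) : Prop :=
  (exists (G : finGroupType) (Q : matroid (dowling_pt r G)),
     [/\ #|G| = g, is_dowling Q & isomorphic Q M])
  \/
  (r = 3 /\
   exists (G : finType) (op : G -> G -> G) (Q : matroid (dowling_pt 3 G)),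
     [/\ quasigroup op, #|G| = g, is_dowling3 op Q & isomorphic Q M]).

(* Main.v *)
(* Write f(h) = h + g C(h,2). Two large hyperplanes of a large flat of rank h  *)

(* Large hyperplanes of a large flat are too big to meet in little. [hyps_genericP] turns this into
   two facts about a sufficiently rich family of them: pairwise meets are large of corank two, and
   the traces on one member stay distinct. Passing to these traces is an induction on rank. It
   yields the bound on their number ([card_large_hyps]) and, for r large hyperplanes, a Boolean
   lattice of large flats ([large_bigcap]), which [large_hyperplanes_frame] encodes as a support
   map.

   Everything about lines is then read off from supports. By [supp_card] counting leaves only
   supports of size one (the basis, [frame_basis]) and two. Any two points of a line have the same
   union of supports, so three points of a line other than a [cflat] lie over the three sides of a
   triangle ([line_supp], [line3P]). Such a line is determined by its points over two sides, hence
   at most g^2 lines per triangle ([card_lines_on]).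

   In the extremal case every pair over adjacent sides spans a three-point line ([adj_line]), which
   gives a partial product [tp]. Its solvability in each argument is the quasigroup of rank three
   ([quasigroup_dowling]). With a fourth index [tp] is associative ([tpA]), and its elements act by
   permutations of one side; these form a group of order g, and the labels multiply as in a Dowling
   geometry ([gain_label_mul], [group_dowling]).

   To recognise the Dowling geometry from its collinearities, [flat_cflat_of] shows that all
   coloured sets with a potential are flats and [flat_colouring] that there are no other flats.
   Their rank is r minus the number of colours ([rk_cflat_of]), and [dowling_flats] selects the
   cyclic ones. *)
(* meet in at least 2f(h-1) - f(h) = f(h-2) - g points, so for h >= 5 the gap  *)
(* condition makes the meet large of rank h-2; for h = 3, 4 inclusion-exclusion *)
(* over three, resp. four, large hyperplanes does the same. By induction there *)
(* are at most h of them, and if there are exactly h, then any k of them meet  *)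
(* in a large flat of rank h-k. Taking all but one gives the basis b_1..b_r.   *)
(* Counting shows that every element lies on some line cl{b_i,b_j}, and a      *)
(* three-point line has one element on each side of a triangle b_i b_j b_k, so *)
(* that it is determined by two of them: there are at most C(r,3) g^2. With    *)
(* equality, x, y on adjacent sides always span a three-point line, say        *)
(* {x, y, tp x y}. For r = 3 this is the quasigroup. For r >= 4 the operation  *)
(* tp is associative along paths i-j-k-l, since otherwise the plane cl{x,y,z}  *)
(* would contain two elements of cl{b_i,b_l}, hence b_i, b_j, b_k, b_l. So the *)
(* elements on the sides act, after identifying the sides at b_0, as one       *)
(* regular permutation group. Finally, the collinearities of a labelled        *)
(* matroid determine all its flats, hence its cyclic flats and their ranks.    *)
Require Import Defs.
From mathcomp Require Import all_boot all_fingroup.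
From mathcomp Require Import zify.

Set Implicit Arguments.
Unset Strict Implicit.
Unset Printing Implicit Defensive.

(* [lia] splits on every boolean hypothesis; only the inequalities matter here. *)
Ltac nlia :=
  repeat match goal with
  | H : is_true ?b |- _ =>
    lazymatch b with
    | leq _ _ => fail
    | leq _ _ && leq _ _ => fail
    | @eq_op _ ?a _ =>
      tryif (let t := type of a in unify t nat) then fail else clear H
    | ~~ (@eq_op _ ?a _) =>
      tryif (let t := type of a in unify t nat) then fail else clear H
    | _ => clear H
    end
  end; unfold reverse_coercion in *; lia.

(** * Closure and flats *)

Section Closure.
Variables (E : finType) (M : matroid E).
Implicit Types (X Y F K C : {set E}) (x y : E).

Lemma rk0 : rk M set0 = 0.
Proof. by have := rk_le_card M set0; rewrite cards0; lia. Qed.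

Lemma rkU1_le x X : rk M (x |: X) <= (rk M X).+1.
Proof.
have := rk_submod M [set x] X; have := rk_le_card M [set x].
by rewrite cards1; lia.
Qed.

Lemma rkU_le X Y : rk M (X :|: Y) <= rk M X + rk M Y.
Proof. by have := rk_submod M X Y; lia. Qed.

(** Submodularity for [x |: X] and [Y], whose intersection still contains [X]. The closure theory
    below rests on this. *)
Lemma rkU_abs X Y x : X \subset Y -> rk M (x |: X) = rk M X ->
  rk M (x |: Y) = rk M Y.
Proof.
move=> sXY eX.
have := rk_submod M (x |: X) Y.
have -> : (x |: X) :|: Y = x |: Y by rewrite -setUA (setUidPr sXY).
have : rk M X <= rk M ((x |: X) :&: Y).
  by apply: rk_mono; rewrite subsetI subsetUr sXY.
have := rk_mono M (subsetUr [set x] Y); lia.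
Qed.

Lemma clP X x : reflect (rk M (x |: X) = rk M X) (x \in cl M X).
Proof. by rewrite inE; apply: eqP. Qed.

Lemma cl_mono X Y : X \subset Y -> cl M X \subset cl M Y.
Proof.
by move=> sXY; apply/subsetP=> x /clP eX; apply/clP; apply: rkU_abs eX.
Qed.

Lemma sub_cl X : X \subset cl M X.
Proof.
apply/subsetP=> x xX; apply/clP; congr rk.
by apply/setUidPr; rewrite sub1set.
Qed.

Lemma rkU_cl X Y : Y \subset cl M X -> rk M (X :|: Y) = rk M X.
Proof.
have [n] := ubnP #|Y|; elim: n Y => // n IHn Y ltYn sY.
have [->|[y yY]] := set_0Vmem Y; first by rewrite setU0.
have <- : rk M (X :|: Y :\ y) = rk M X.
  apply: IHn; last exact: subset_trans (subD1set _ _) sY.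
  by rewrite (cardsD1 y Y) yY in ltYn.
rewrite -{1}(setD1K yY) setUCA; apply: rkU_abs (subsetUl _ _) _.
exact/clP/(subsetP sY).
Qed.

Lemma rk_cl X : rk M (cl M X) = rk M X.
Proof. by have := rkU_cl (subxx (cl M X)); rewrite (setUidPr (sub_cl X)). Qed.

Lemma rk_sub_cl X Y : X \subset cl M Y -> rk M X <= rk M Y.
Proof. by move=> sXY; rewrite -(rk_cl Y) rk_mono. Qed.

Lemma flat_cl X : flat M (cl M X).
Proof.
rewrite /flat eqEsubset sub_cl andbT; apply/subsetP=> x /clP eX.
apply/clP; apply/eqP; rewrite eqn_leq [X in _ && X]rk_mono ?subsetUr // andbT.
by rewrite -(rk_cl X) -eX rk_mono // setUS // sub_cl.
Qed.

Lemma flatP F : flat M F -> cl M F = F. Proof. exact: eqP. Qed.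

Lemma cl_sub X F : flat M F -> (cl M X \subset F) = (X \subset F).
Proof.
move=> /flatP fF; apply/idP/idP; first exact/subset_trans/sub_cl.
by move/cl_mono; rewrite fF.
Qed.

Lemma clU_cl X Y : cl M (X :|: cl M Y) = cl M (X :|: Y).
Proof.
apply/eqP; rewrite eqEsubset [X in _ && X]cl_mono ?setUS ?sub_cl // andbT.
rewrite cl_sub ?flat_cl // subUset cl_mono ?subsetUr // andbT.
exact: subset_trans (subsetUl _ _) (sub_cl _).
Qed.

Lemma rkU1_flat F x : flat M F -> x \notin F -> rk M (x |: F) = (rk M F).+1.
Proof.
move=> /flatP fF; rewrite -{1}fF => /clP ne.
have := rkU1_le x F; have := rk_mono M (subsetUr [set x] F); lia.
Qed.

Lemma flat_rkI F : (forall x, x \notin F -> rk M F < rk M (x |: F)) -> flat M F.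
Proof.
move=> hF; rewrite /flat eqEsubset sub_cl andbT; apply/subsetP=> x /clP ex.
by apply: contraT => /hF; rewrite ex ltnn.
Qed.

Lemma flat_ltn F K : flat M F -> F \proper K -> rk M F < rk M K.
Proof.
move=> fF /properP[sFK [x xK xF]].
by rewrite -(rkU1_flat fF xF) rk_mono // subUset sub1set xK.
Qed.

Lemma flat_eq F K : flat M F -> F \subset K -> rk M K <= rk M F -> F = K.
Proof.
move=> fF sFK le; apply/eqP; rewrite eqEproper sFK; apply/negP=> /(flat_ltn fF).
by rewrite ltnNge le.
Qed.

Lemma flatT : flat M [set: E].
Proof. by rewrite /flat -subTset sub_cl. Qed.

Lemma flatI F K : flat M F -> flat M K -> flat M (F :&: K).
Proof.
move=> fF fK; rewrite /flat eqEsubset sub_cl andbT subsetI.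
by rewrite !cl_sub // subsetIl subsetIr.
Qed.

Lemma flat_bigcap (I : finType) (P : pred I) (F : I -> {set E}) :
  (forall i, P i -> flat M (F i)) -> flat M (\bigcap_(i | P i) F i).
Proof. by move=> fF; elim/big_ind: _ => // [|*]; [exact: flatT|exact: flatI]. Qed.

Lemma cl_rk X F : flat M F -> X \subset F -> rk M F <= rk M X -> cl M X = F.
Proof. by move=> fF sXF le; apply: flat_eq; rewrite ?flat_cl ?cl_sub // rk_cl. Qed.

Lemma simple_matroidP :
  reflect (forall X, #|X| <= 2 -> rk M X = #|X|) (simple_matroid M).
Proof.
apply: (iffP forallP) => [sM X leX | rkM C].
  have [//|dX] := eqVneq (rk M X) #|X|.
  have [C minC sCX] : {C | minset [pred X | ~~ indep M X] C & C \subset X}.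
    exact: minset_exists.
  by have /implyP/(_ minC) := sM C; have := subset_leq_card sCX; lia.
apply/implyP=> /minsetp /=; rewrite ltnNge; apply: contra => leC.
exact/eqP/rkM.
Qed.

Lemma circuit_cl C x : circuit M C -> x \in C -> x \in cl M (C :\ x).
Proof.
move=> cC xC; apply/clP; rewrite setD1K //.
have: indep M (C :\ x).
  apply: contraT => dC; have /minsetP[_ /(_ (C :\ x) dC (subD1set _ _))] := cC.
  by move/setP/(_ x); rewrite xC !inE eqxx.
move/eqP=> eC; have /minsetp/= := cC; rewrite /indep (cardsD1 x) xC.
have := rkU1_le x (C :\ x); rewrite setD1K //.
have := rk_mono M (subD1set C x); have := rk_le_card M (C :\ x).
lia.
Qed.

Lemma circuit3 C : simple_matroid M -> #|C| = 3 -> rk M C <= 2 -> circuit M C.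
Proof.
move=> /simple_matroidP sM C3 rC; apply/minsetP; split=> [|X /= dX sXC].
  by rewrite /= /indep C3; lia.
apply/eqP; rewrite eqEcard sXC C3; apply: contraT; rewrite -leqNgt => leX.
by rewrite /indep sM ?eqxx in dX.
Qed.

(** A circuit of [F] through [x] would put [x] into the closure of the flat [F :\ x]. *)
Lemma coloop_not_cyclic F x : flat M (F :\ x) -> x \in F -> ~~ cyclic_flat M F.
Proof.
move=> fFx xF; apply/negP=> /andP[fF /eqP eF].
move: (xF); rewrite eF => /bigcupP[C]; rewrite inE => /andP[cC sCF] xC.
have := circuit_cl cC xC; move/(subsetP (cl_mono (setSD _ sCF))).
by rewrite (flatP fFx) !inE eqxx.
Qed.

Section Simple.
Hypothesis sM : simple_matroid M.

Lemma rk_small X : #|X| <= 2 -> rk M X = #|X|.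
Proof. exact/simple_matroidP. Qed.

Lemma rk1 x : rk M [set x] = 1. Proof. by rewrite rk_small cards1. Qed.

Lemma rk2 x y : x != y -> rk M [set x; y] = 2.
Proof. by move=> ne; rewrite rk_small cards2 ne. Qed.

Lemma flat_card_rk1 F : rk M F <= 1 -> #|F| = rk M F.
Proof.
move=> rF; suff le1 : #|F| <= 1 by rewrite rk_small //; lia.
apply: contraT; rewrite -ltnNge => /card_gt1P[x [y [xF yF ne]]].
have := rk2 ne; have : rk M [set x; y] <= rk M F by rewrite rk_mono // subUset !sub1set xF.
lia.
Qed.

Lemma flat0 : flat M set0.
Proof. by apply: flat_rkI => x _; rewrite setU0 rk1 rk0. Qed.

Lemma cl2_line F x y : line M F -> x \in F -> y \in F -> x != y ->
  cl M [set x; y] = F.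
Proof.
move=> /andP[fF /eqP rF] xF yF ne; apply: cl_rk; rewrite ?rk2 ?rF //.
by rewrite subUset !sub1set xF.
Qed.

Lemma line_cl2 x y : x != y -> line M (cl M [set x; y]).
Proof. by move=> ne; rewrite /line flat_cl rk_cl rk2. Qed.

End Simple.
End Closure.

(** * Inclusion-exclusion for three and four sets *)

Section FiniteSets.
Variable T : finType.
Implicit Types A B C D : {set T}.

Lemma ltn_card_exists A B : #|A| < #|B| -> exists2 x, x \in B & x \notin A.
Proof.
move=> lt; have /subsetPn[x xB xA] : ~~ (B \subset A).
  by apply: contraL lt => /subset_leq_card; rewrite -leqNgt.
by exists x.
Qed.

Lemma cardsU3 A B C :
  #|A :|: B :|: C| + #|A :&: B| + #|A :&: C| + #|B :&: C| =
  #|A| + #|B| + #|C| + #|A :&: B :&: C|.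
Proof.
have := cardsUI (A :|: B) C; have := cardsUI A B.
by rewrite setIUl; have := cardsUI (A :&: C) (B :&: C); rewrite setIACA setIid; lia.
Qed.

(** Inclusion-exclusion for the three traces on [A], whose union has at most [#|A|] elements. *)
Lemma cardsI3_le A B C D :
  #|A :&: B| + #|A :&: C| + #|A :&: D| <=
  #|A| + #|A :&: B :&: C| + #|A :&: B :&: D| + #|A :&: C :&: D|.
Proof.
have := cardsU3 (A :&: B) (A :&: C) (A :&: D).
have eI X Y : (A :&: X) :&: (A :&: Y) = A :&: X :&: Y by rewrite setIACA setIid setIA.
rewrite !eI -!setIUr; have := subset_leq_card (subsetIl A (B :|: C :|: D)); nlia.
Qed.

End FiniteSets.

Definition lsize (g h : nat) := h + g * 'C(h, 2).

Lemma lsizeS g h : lsize g h.+1 = lsize g h + 1 + g * h.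
Proof. by rewrite /lsize binS bin1 mulnDr; lia. Qed.

Lemma leq_lsize g h k : h <= k -> lsize g h <= lsize g k.
Proof. by move=> le; rewrite leq_add // leq_mul // leq_bin2l. Qed.

Lemma lsize_small g :
  (lsize g 0 = 0) * (lsize g 1 = 1) * (lsize g 2 = g + 2) *
  (lsize g 3 = 3 * g + 3) * (lsize g 4 = 6 * g + 4).
Proof.
have e : lsize g 0 = 0 by rewrite /lsize bin0n; lia.
by do !split; rewrite ?lsizeS e; lia.
Qed.

(** * Large flats *)

Section LargeFlats.
Variables (g r : nat) (hg : 2 <= g).
Variables (E : finType) (M : matroid E).
Hypothesis sM : simple_matroid M.
Hypothesis hbound : forall F : {set E}, flat M F ->
  #|F| <= rk M F + g * 'C(rk M F, 2).
Hypothesis hgap : forall F : {set E}, flat M F -> 2 < rk M F < r ->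
  ~~ large M g F -> #|F| <= rk M F + g * 'C(rk M F - 1, 2).
Implicit Types (F H K : {set E}) (S : {set {set E}}).

Definition large_rk F h := large M g F && (rk M F == h).

Lemma large_rkP F h :
  reflect [/\ flat M F, #|F| = lsize g h & rk M F = h] (large_rk F h).
Proof.
apply: (iffP andP) => [[/andP[fF /eqP cF] /eqP <-] //|[fF cF rF]].
by rewrite /large fF cF rF !eqxx.
Qed.

Lemma flat_card_le F h : flat M F -> rk M F <= h -> #|F| <= lsize g h.
Proof. by move=> /hbound fF /(leq_lsize g); apply: leq_trans. Qed.

Lemma flat_card_rk F h : flat M F -> lsize g h < #|F| -> h < rk M F.
Proof. by move=> fF; apply: contraTT; rewrite -!leqNgt; apply: flat_card_le. Qed.

(** [lsize g] is strictly increasing, so by [hbound] a flat of rank below h is too small; an upper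
    bound on the rank pins it down. *)
Lemma flat_large F h : flat M F -> rk M F <= h -> #|F| = lsize g h ->
  large_rk F h.
Proof.
move=> fF leF cF; apply/large_rkP; split=> //; apply/eqP; rewrite eqn_leq leF.
case: h cF {leF} => // h cF; apply: flat_card_rk => //; rewrite cF lsizeS; lia.
Qed.

Definition large_hyps F : {set {set E}} :=
  [set H : {set E} | (H \subset F) && large_rk H (rk M F).-1].

Lemma rk_hypI F H H' h : large_rk F h.+2 -> H \in large_hyps F ->
  H' \in large_hyps F -> H != H' ->
  [/\ flat M (H :&: H'), rk M (H :&: H') <= h & H :|: H' \subset F].
Proof.
case/large_rkP=> _ _ rF; rewrite !inE rF /=.
case/andP=> sH /large_rkP[fH _ rH] /andP[sH' /large_rkP[fH' _ rH']] ne.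
have fI := flatI fH fH'; split=> //; last by rewrite subUset sH.
rewrite -ltnS -rH flat_ltn // properE subsetIl subsetI subxx /=.
by apply: contra ne => sHH'; rewrite (flat_eq fH sHH') // rH rH'.
Qed.

Lemma card_hyp F H h : large_rk F h.+1 -> H \in large_hyps F -> #|H| = lsize g h.
Proof. by case/large_rkP=> _ _ rF; rewrite !inE rF => /andP[_ /large_rkP[]]. Qed.

(* Can fail when [S] is small: two lines of a plane need not meet. *)
Definition hyps_generic F S := forall H, H \in S ->
  (forall H', H' \in S -> H' != H -> large_rk (H :&: H') (rk M F).-2) /\
  {in S :\ H &, injective (setI H)}.

(** A large plane has 3g + 3 points, its large lines g + 2. Three of these meet pairwise in at most
    one point, so inclusion-exclusion forces them to be a triangle covering the plane. A fourth
    would consist of its meets with these three, at most 3 < g + 2 points. *)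
Lemma hyps_generic3 F S : large_rk F 3 -> S \subset large_hyps F -> 3 <= #|S| ->
  hyps_generic F S /\ #|S| <= 3.
Proof.
move=> lF /subsetP sS S3; have [fF cF rF] := large_rkP _ _ lF.
have triple H1 H2 H3 : H1 \in S -> H2 \in S -> H3 \in S ->
    H1 != H2 -> H1 != H3 -> H2 != H3 ->
    [/\ #|H1 :&: H2| = 1, H1 :&: H2 != H1 :&: H3 & H1 :|: H2 :|: H3 = F].
  move=> /sS S1 /sS S2 /sS S3' n12 n13 n23.
  have [f12 r12 u12] := rk_hypI lF S1 S2 n12.
  have [f13 r13 u13] := rk_hypI lF S1 S3' n13.
  have [f23 r23 u23] := rk_hypI lF S2 S3' n23.
  have := cardsU3 H1 H2 H3.
  rewrite (card_hyp lF S1) (card_hyp lF S2) (card_hyp lF S3').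
  have sU : H1 :|: H2 :|: H3 \subset F.
    by rewrite -[H3]setUid setUACA subUset u13.
  have cU := subset_leq_card sU.
  have := flat_card_le f12 r12; have := flat_card_le f13 r13.
  have := flat_card_le f23 r23.
  move: cF cU; rewrite !lsize_small => cF cU h1 h2 h3 h4; split; first by nlia.
    apply/eqP=> e; move: h4.
    have -> : H1 :&: H2 :&: H3 = H1 :&: H2 by apply/setIidPl; rewrite e subsetIr.
    rewrite -e; nlia.
  by apply/eqP; rewrite eqEcard sU; nlia.
split.
  move=> H HS; split=> [H' HS' ne|].
    have [|H3 H3S] := @ltn_card_exists _ [set H; H'] S.
      by rewrite cards2; have := leq_b1 (H != H'); nlia.
    rewrite !inE negb_or => /andP[n1 n2].
    rewrite eq_sym in ne; rewrite eq_sym in n1; rewrite eq_sym in n2.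
    have [c1 _ _] := triple _ _ _ HS HS' H3S ne n1 n2.
    have [fI rI _] := rk_hypI lF (sS _ HS) (sS _ HS') ne.
    by rewrite rF; apply: flat_large => //; rewrite c1 lsize_small.
  move=> H1 H2; rewrite !inE => /andP[n1 S1] /andP[n2 S2] e; apply/eqP.
  apply: contraT => n12; rewrite eq_sym in n1; rewrite eq_sym in n2.
  by have [_ /eqP] := triple _ _ _ HS S1 S2 n1 n2 n12.
have [H1 S1] : exists H, H \in S by apply/card_gt0P; nlia.
have [|H2 S2] := @ltn_card_exists _ [set H1] S; first by rewrite cards1; nlia.
rewrite !inE => n12.
have [|H3 S3'] := @ltn_card_exists _ [set H1; H2] S.
  by rewrite cards2; have := leq_b1 (H1 != H2); nlia.
rewrite !inE negb_or => /andP[n13 n23].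
rewrite leqNgt; apply/negP=> lt.
have [|H4 S4] := @ltn_card_exists _ [set H1; H2; H3] S.
  by rewrite -setUA; do 2!rewrite cardsU1; rewrite cards1; nlia.
rewrite !inE !negb_or -andbA => /and3P[n14 n24 n34].
rewrite eq_sym in n12; rewrite eq_sym in n13; rewrite eq_sym in n23.
have [_ _ eU] := triple _ _ _ S1 S2 S3' n12 n13 n23.
have c4 := card_hyp lF (sS _ S4).
have s4 : H4 \subset F by have := sS _ S4; rewrite inE => /andP[].
have : H4 = (H4 :&: H1) :|: (H4 :&: H2) :|: (H4 :&: H3).
  by rewrite -!setIUr eU; apply/esym/setIidPl.
move/(congr1 (fun A : {set E} => #|A|)).
have [c41 _ _] := triple _ _ _ S4 S1 S2 n14 n24 n12.
have [c42 _ _] := triple _ _ _ S4 S2 S1 n24 n14 (negbT (introF eqP (fun e => negP n12 (introT eqP (esym e))))).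
have [c43 _ _] := triple _ _ _ S4 S3' S1 n34 n14 (negbT (introF eqP (fun e => negP n13 (introT eqP (esym e))))).
have := cardsU (H4 :&: H1 :|: H4 :&: H2) (H4 :&: H3).
have := cardsU (H4 :&: H1) (H4 :&: H2).
rewrite c41 c42 c43 c4 !lsize_small; nlia.
Qed.

(** The sizes are 6g + 4 for [F], 3g + 3 for a large plane, at most g + 2 for a meet of two.
    Inclusion-exclusion is summed over the three triples containing [H1], and [cardsI3_le] bounds
    their triple meets from below. The six pairwise meets then total at least 6(g + 2), so each
    attains its bound. *)
Lemma hyps_generic4 F S : large_rk F 4 -> S \subset large_hyps F -> 4 <= #|S| ->
  hyps_generic F S.
Proof.
move=> lF /subsetP sS S4; have [fF cF rF] := large_rkP _ _ lF.
have triple H1 H2 H3 : H1 \in S -> H2 \in S -> H3 \in S ->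
    H1 != H2 -> H1 != H3 -> H2 != H3 ->
    [/\ #|H1 :&: H2| = g + 2 & H1 :&: H2 != H1 :&: H3].
  move=> S1 S2 S3 n12 n13 n23.
  (* The count for three planes alone leaves a slack of one point; a fourth plane removes it. *)
  have [|H4 S4'] := @ltn_card_exists _ [set H1; H2; H3] S.
    by rewrite -setUA; do 2!rewrite cardsU1; rewrite cards1; nlia.
  rewrite !inE !negb_or -andbA => /and3P[n14 n24 n34].
  rewrite eq_sym in n14; rewrite eq_sym in n24; rewrite eq_sym in n34.
  move: S1 S2 S3 S4' => /sS S1 /sS S2 /sS S3 /sS S4'.
  have [f12 r12 u12] := rk_hypI lF S1 S2 n12.
  have [f13 r13 u13] := rk_hypI lF S1 S3 n13.
  have [f23 r23 u23] := rk_hypI lF S2 S3 n23.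
  have [f14 r14 u14] := rk_hypI lF S1 S4' n14.
  have [f24 r24 u24] := rk_hypI lF S2 S4' n24.
  have [f34 r34 u34] := rk_hypI lF S3 S4' n34.
  have sU A B C : A :|: B \subset F -> A :|: C \subset F ->
      #|A :|: B :|: C| <= #|F|.
    move=> sAB sAC; apply: subset_leq_card; rewrite subUset sAB.
    exact: subset_trans (subsetUr _ _) sAC.
  have c1 := card_hyp lF S1; have c2 := card_hyp lF S2.
  have c3 := card_hyp lF S3; have c4 := card_hyp lF S4'.
  have := cardsU3 H1 H2 H3; have := sU _ _ _ u12 u13.
  have := cardsU3 H1 H2 H4; have := sU _ _ _ u12 u14.
  have := cardsU3 H1 H3 H4; have := sU _ _ _ u13 u14.
  have := cardsI3_le H1 H2 H3 H4.
  have := flat_card_le f12 r12; have := flat_card_le f13 r13.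
  have := flat_card_le f14 r14; have := flat_card_le f23 r23.
  have := flat_card_le f24 r24; have := flat_card_le f34 r34.
  rewrite c1 c2 c3 c4 cF !lsize_small => *; split; first by nlia.
  apply/eqP=> e; have e' : H1 :&: H2 :&: H3 = H1 :&: H2.
    by apply/setIidPl; rewrite e subsetIr.
  move: e' => /(congr1 (fun A : {set E} => #|A|)); nlia.
have third H1 H2 : exists H3, [/\ H3 \in S, H1 != H3 & H2 != H3].
  have [|H3 S3] := @ltn_card_exists _ [set H1; H2] S.
    by rewrite cards2; have := leq_b1 (H1 != H2); nlia.
  by rewrite !inE negb_or ![H3 == _]eq_sym => /andP[n1 n2]; exists H3.
move=> H HS; split=> [H' HS'|H1 H2].
  rewrite eq_sym => ne; have [H3 [H3S n1 n2]] := third H H'.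
  have [c1 _] := triple _ _ _ HS HS' H3S ne n1 n2.
  have [fI rI _] := rk_hypI lF (sS _ HS) (sS _ HS') ne.
  by rewrite rF; apply: flat_large => //; rewrite c1 !lsize_small; nlia.
rewrite !inE ![_ == H]eq_sym => /andP[n1 S1] /andP[n2 S2] e; apply/eqP.
apply: contraT => n12.
by have [_ /eqP] := triple _ _ _ HS S1 S2 n1 n2 n12.
Qed.

(** With f for [lsize g], a meet has at least f(h-2) - g points. This exceeds f(h-3), which fixes
    the rank at h - 2, and also the gap bound f(h-2) - g(h-3), which makes the meet large. From h =
    5 on, the rank h - 2 is in the range of [hgap]. *)
Lemma hyps_generic5 F S h : h <= r -> 5 <= h -> large_rk F h ->
  S \subset large_hyps F -> hyps_generic F S.
Proof.
move=> ler; case: h ler => [|[|[|[|[|h]]]]] // ler _ lF /subsetP sS.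
have [fF cF rF] := large_rkP _ _ lF.
have pair H1 H2 : H1 \in S -> H2 \in S -> H1 != H2 -> large_rk (H1 :&: H2) h.+3.
  move=> /sS S1 /sS S2 n12; have [fI rI uI] := rk_hypI lF S1 S2 n12.
  have := subset_leq_card uI; have := cardsUI H1 H2.
  rewrite (card_hyp lF S1) (card_hyp lF S2) cF !lsizeS => cI uI'.
  have rI3 : rk M (H1 :&: H2) = h.+3.
    apply/eqP; rewrite eqn_leq rI; apply: flat_card_rk => //.
    rewrite !lsizeS; nlia.
  apply/large_rkP; split=> //; rewrite -rI3.
  have [lI|nlI] := boolP (large M g (H1 :&: H2)).
    by case/andP: lI => _ /eqP.
  have := hgap fI _ nlI; rewrite rI3 subn1 /= => /(_ ltac:(nlia)).
  have : lsize g h.+3 = h.+3 + g * 'C(h.+2, 2) + g * h.+2.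
    by rewrite lsizeS /lsize; nlia.
  rewrite !lsizeS; nia.
move=> H HS; rewrite rF; split=> [H' HS' |].
  by rewrite eq_sym => ne; apply: pair.
move=> H1 H2; rewrite !inE ![_ == H]eq_sym => /andP[n1 S1] /andP[n2 S2] e.
apply/eqP; apply: contraT => n12.
have [_ c01 r01] := large_rkP _ _ (pair _ _ HS S1 n1).
have [_ c02 r02] := large_rkP _ _ (pair _ _ HS S2 n2).
have [_ c12 r12] := large_rkP _ _ (pair _ _ S1 S2 n12).
(* With n the rank of [F], three hyperplanes through one flat of size f(n-2) would cover 3f(n-1) -
   2f(n-2) > f(n) points. *)
have eK : H :&: H1 :&: H2 = H :&: H1.
  by apply/setIidPl; rewrite e subsetIr.
have := cardsU3 H H1 H2.
have [_ _ u1] := rk_hypI lF (sS _ HS) (sS _ S1) n1.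
have [_ _ u2] := rk_hypI lF (sS _ HS) (sS _ S2) n2.
have : #|H :|: H1 :|: H2| <= #|F|.
  apply: subset_leq_card; rewrite subUset u1.
  exact: subset_trans (subsetUr _ _) u2.
rewrite eK c01 c02 c12 cF.
rewrite (card_hyp lF (sS _ HS)) (card_hyp lF (sS _ S1)) (card_hyp lF (sS _ S2)).
rewrite !lsizeS; nlia.
Qed.

Lemma hyps_genericP F S h : h <= r -> large_rk F h -> S \subset large_hyps F ->
  (if h < 3 then #|S| == h else h <= #|S|) -> hyps_generic F S.
Proof.
move=> ler lF sS; have [fF cF rF] := large_rkP _ _ lF.
case: ltnP => [h3 /eqP cS|h3 cS]; last first.
  have [h5|h5] := leqP 5 h; first exact: hyps_generic5 lF sS.
  have [e|e] : h = 3 \/ h = 4 by nlia.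
    by rewrite e in lF cS; case: (hyps_generic3 lF sS cS).
  by rewrite e in lF cS; apply: hyps_generic4.
move=> H HS; have cH := cardsD1 H S; rewrite HS in cH; split.
  move=> H' HS' ne; have cH' := cardsD1 H' (S :\ H).
  rewrite !inE ne HS' in cH'; have e : h = 2 by nlia.
  have HF := subsetP sS _ HS; have HF' := subsetP sS _ HS'.
  rewrite e in lF; rewrite eq_sym in ne.
  have [fI rI _] := rk_hypI lF HF HF' ne.
  rewrite rF e; apply/large_rkP; split=> //; last by nlia.
  by rewrite (flat_card_rk1 sM) /= ?lsize_small; nlia.
move=> H1 H2 H1S H2S _.
suff /cards1P[x e] : #|S :\ H| == 1.
  by move: H1S H2S; rewrite e !inE => /eqP-> /eqP->.
have : 0 < #|S :\ H| by apply/card_gt0P; exists H1.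
nlia.
Qed.

Definition cut S H : {set {set E}} := [set H :&: H' | H' in S :\ H].

(** The inductive step on rank: a generic family in [F] restricts to a family in [H] with just one
    member fewer. *)
Lemma cut_large_hyps F S H : hyps_generic F S -> S \subset large_hyps F ->
  H \in S -> cut S H \subset large_hyps H /\ #|cut S H| = #|S|.-1.
Proof.
move=> gS /subsetP sS HS; have [gS1 gS2] := gS _ HS.
split; last by rewrite card_in_imset // (cardsD1 H S) HS.
apply/subsetP=> _ /imsetP[H' /setD1P[ne HS'] ->].
have := sS _ HS; rewrite !inE subsetIl => /andP[_ /large_rkP[_ _ ->]].
exact: gS1.
Qed.

(** Too many hyperplanes of [F] would cut down to too many hyperplanes of one of them; the descent
    ends with the triangle of rank three. *)
Lemma card_large_hyps F h : 3 <= h <= r -> large_rk F h ->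
  #|large_hyps F| <= h.
Proof.
elim: h F => // h IHh F /andP[h3 ler] lF; rewrite leqNgt; apply/negP=> lt.
have gF : hyps_generic F (large_hyps F).
  by apply: (hyps_genericP ler lF (subxx _)); rewrite [h.+1 < 3]ltnNge h3 ltnW.
have [h2|h2] := ltnP 2 h; last first.
  have e : h.+1 = 3 by nlia.
  rewrite e in lF lt.
  have [] := hyps_generic3 lF (subxx _) (ltnW lt); nlia.
have [H HF] : exists H, H \in large_hyps F by apply/card_gt0P; nlia.
have [sC cC] := cut_large_hyps gF (subxx _) HF.
have lH : large_rk H h.
  by move: HF; rewrite inE; have [_ _ ->] := large_rkP _ _ lF => /andP[].
have := IHh H _ lH; rewrite h2 ltnW // => /(_ isT).
have := subset_leq_card sC; nlia.
Qed.

(** Induction on the rank, cutting by a member of [S']: family size and rank drop together, so they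
    stay equal. The intersection with [F] covers the case of empty [S']. *)
Lemma large_bigcap F S S' h : h <= r -> large_rk F h -> S \subset large_hyps F ->
  #|S| = h -> S' \subset S -> large_rk (F :&: \bigcap_(H in S') H) (h - #|S'|).
Proof.
elim: h F S S' => [|h IHh] F S S' ler lF sS cS sS'.
  have -> : S' = set0.
    by apply/eqP; rewrite -subset0 -(cards0_eq cS).
  by rewrite big_set0 setIT cards0.
have [->|[H HS']] := set_0Vmem S'; first by rewrite big_set0 setIT cards0.
have HS := subsetP sS' _ HS'.
have gF : hyps_generic F S.
  by apply: (hyps_genericP ler lF sS); rewrite cS eqxx leqnn; case: ifP.
have [sC cC] := cut_large_hyps gF sS HS.
have HF := subsetP sS _ HS.
have [sHF lH] : H \subset F /\ large_rk H h.
  by move: HF; rewrite inE; have [_ _ ->] := large_rkP _ _ lF => /andP[].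
have sS'' : cut S' H \subset cut S H by apply: imsetS; apply: setSD.
have := IHh H _ _ (ltnW ler) lH sC _ sS''; rewrite cC cS => /(_ erefl).
have -> : #|cut S' H| = #|S'|.-1.
  rewrite card_in_imset ?(cardsD1 H S') ?HS' //.
  by move=> A B AS BS; have [_] := gF _ HS; apply; apply: (subsetP (setSD _ sS')).
have -> : H :&: \bigcap_(K in cut S' H) K = F :&: \bigcap_(K in S') K.
  apply/setP=> x; rewrite !inE; apply/andP/andP=> [[xH /bigcapP xC]|[xF /bigcapP xC]].
    split; first exact: subsetP xH.
    apply/bigcapP=> K KS; have [->//|ne] := eqVneq K H.
    suff : x \in H :&: K by case/setIP.
    by apply: xC; apply/imsetP; exists K; rewrite ?inE ?ne.
  split; first exact: xC.
  apply/bigcapP=> _ /imsetP[K /setD1P[_ KS] ->].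
  by rewrite inE !xC.
have : 0 < #|S'| by apply/card_gt0P; exists H.
by case: #|S'| => // n _; rewrite subSS.
Qed.

End LargeFlats.

(** * Collinear triples *)

Section Collinear.
Variables (E : finType) (M : matroid E).
Hypothesis sM : simple_matroid M.
Implicit Types (x y z : E) (X : {set E}).

(** Triples with a repeated point count as collinear, hence the distinctness premise in
    [flat_col]. *)
Definition col x y z := rk M [set x; y; z] <= 2.

Lemma colC x y z : col x y z = col y x z.
Proof. by rewrite /col [[set x; y]]setUC. Qed.

Lemma colCA x y z : col x y z = col x z y.
Proof. by rewrite /col setUAC. Qed.

Lemma flat_col X x y z : flat M X -> col x y z -> x != y ->
  x \in X -> y \in X -> z \in X.
Proof.
move=> fX c ne xX yX.
have sX : [set x; y] \subset X by rewrite subUset !sub1set xX.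
move: (sX); rewrite -(cl_sub _ fX) => /subsetP; apply.
apply/clP; have := rk_mono M (subsetUr [set z] [set x; y]).
by rewrite (rk2 sM ne) -[in rk M (z |: _)]setUC => le; apply/eqP; rewrite eqn_leq le andbT.
Qed.

Lemma col_rk X x y z : flat M X -> rk M X <= 2 ->
  x \in X -> y \in X -> z \in X -> col x y z.
Proof.
move=> fX r2 xX yX zX; apply: leq_trans r2; apply: rk_mono.
by rewrite !subUset !sub1set xX yX.
Qed.

Lemma card3 x y z : x != y -> x != z -> y != z -> #|[set x; y; z]| = 3.
Proof.
move=> nxy nxz nyz; rewrite setUC cardsU1 cards2 nxy !inE negb_or.
by rewrite ![z == _]eq_sym nxz nyz.
Qed.

End Collinear.

(** * Cyclic flats of a labelled matroid *)

Section Points.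
Variables (r : nat) (G : finGroupType).
Implicit Types (i j k l : 'I_r) (a b c : G) (x y : dowling_pt r G).
Local Open Scope group_scope.

(* The convention a_(i,j) = (a^-1)_(j,i); the value is junk for i = j. *)
Definition pt i j c : dowling_pt r G :=
  match insub (i, j) : option {ij : 'I_r * 'I_r | ij.1 < ij.2}, insub (j, i) with
  | Some ij, _ => inr (c, ij)
  | _, Some ji => inr (c^-1, ji)
  | _, _ => inl i
  end.

Lemma pt_lt i j c (lt : i < j) : pt i j c = pt_a c lt.
Proof.
by rewrite /pt insubT /pt_a //=; congr (inr (_, _)); apply: val_inj; rewrite /= SubK.
Qed.

Lemma pt_sym i j c : i != j -> pt j i c^-1 = pt i j c.
Proof.
rewrite neq_ltn => /orP[] lt; rewrite /pt.
  by rewrite insubF ?insubT ?invgK //=; apply/negbTE; rewrite -leqNgt ltnW.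
by rewrite insubT //= [insub (i, j)]insubF //=; apply/negbTE; rewrite -leqNgt ltnW.
Qed.

Lemma pt_inv i j c : i != j -> pt i j c^-1 = pt j i c.
Proof. by move=> ne; rewrite pt_sym // eq_sym. Qed.

Lemma ptP x : (exists i, x = inl i) \/
  exists i j c (lt : i < j), x = pt i j c /\ x = pt_a c lt.
Proof.
case: x => [i|[c [[i j] lt]]]; first by left; exists i.
by right; exists i, j, c, lt; rewrite pt_lt.
Qed.

Definition sup x : {set 'I_r} :=
  match x with inl i => [set i] | inr (_, ij) => [set (val ij).1; (val ij).2] end.

Lemma sup_pt i j c : i != j -> sup (pt i j c) = [set i; j].
Proof.
move=> ne; have := ne; rewrite neq_ltn => /orP[] lt; first by rewrite (pt_lt c lt).
by rewrite -pt_sym // (pt_lt _ lt) /= setUC.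
Qed.

Lemma pt_neq_inl i j c k : i != j -> pt i j c != inl k.
Proof.
move=> ne; apply/eqP=> /(congr1 (fun x => #|sup x|)).
by rewrite sup_pt //= cards2 cards1 ne.
Qed.

Lemma pt_inj i j : i != j -> injective (pt i j).
Proof.
move=> ne a b; have := ne; rewrite neq_ltn => /orP[] lt.
  by rewrite !(pt_lt _ lt) => -[].
by rewrite -!(pt_sym _ ne) !(pt_lt _ lt) => -[] /invg_inj.
Qed.

Lemma pt_neq_sup i j k l a b : i != j -> k != l -> [set i; j] != [set k; l] ->
  pt i j a != pt k l b.
Proof.
by move=> n1 n2; apply: contraNneq => /(congr1 sup); rewrite !sup_pt // => ->.
Qed.

Lemma pt_neq3 i j k a b : i != j -> j != k -> i != k -> pt i j a != pt j k b.
Proof.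
move=> nij njk nik; apply: pt_neq_sup => //; apply/eqP=> /setP/(_ i).
by rewrite !inE eqxx (negPf nij) (negPf nik).
Qed.

End Points.
Arguments pt {r G}.

Section DowlingFlats.
Variables (r : nat) (G : finGroupType) (Q : matroid (dowling_pt r G)).
Hypotheses (sQ : simple_matroid Q) (rQ : mrank Q = r).
Local Open Scope group_scope.
Hypothesis edge_col : forall (i j : 'I_r) (c : G),
  i < j -> col Q (inl i) (inl j) (pt i j c).
Hypothesis tri_col : forall (i j k : 'I_r) (a b : G),
  i < j -> j < k -> col Q (pt i j a) (pt j k b) (pt i k (a * b)).
Implicit Types (i j k l : 'I_r) (a b c : G) (x y : dowling_pt r G).
Implicit Types (X : {set dowling_pt r G}) (I J : {set 'I_r}) (p : 'I_r -> G).

Lemma edge_colS i j c : i != j -> col Q (inl i) (inl j) (pt i j c).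
Proof.
move=> ne; have := ne; rewrite neq_ltn => /orP[] lt; first exact: edge_col.
by rewrite colC -pt_sym // edge_col.
Qed.

(** Under a_(i,j) = (a^-1)_(j,i) the relation ab = c keeps its shape when the indices are permuted,
    so all six orders reduce to the sorted one. *)
Lemma tri_colS i j k a b : i != j -> j != k -> i != k ->
  col Q (pt i j a) (pt j k b) (pt i k (a * b)).
Proof.
move=> nij njk nik.
have [lij|lji|/val_inj e] := ltngtP i j; last by rewrite e eqxx in nij.
  have [ljk|lkj|/val_inj e] := ltngtP j k; last by rewrite e eqxx in njk.
    exact: tri_col.
  have [lik|lki|/val_inj e] := ltngtP i k; last by rewrite e eqxx in nik.
    have := tri_col (a * b) b^-1 lik lkj; rewrite mulgK (pt_inv _ _) 1?eq_sym //.
    by rewrite colC colCA colC colCA colC.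
  have := tri_col (a * b)^-1 a lki lij; rewrite invMg mulgKV -invMg.
  by rewrite !pt_sym // colC colCA.
have [ljk|lkj|/val_inj e] := ltngtP j k; last by rewrite e eqxx in njk.
  have [lik|lki|/val_inj e] := ltngtP i k; last by rewrite e eqxx in nik.
    have := tri_col a^-1 (a * b) lji lik; rewrite mulKg pt_sym //.
    by rewrite colCA.
  have := tri_col b (a * b)^-1 ljk lki; rewrite invMg mulKVg !pt_sym // colC colCA -invMg pt_sym //.
  by rewrite colC colCA colC.
have lki := ltn_trans lkj lji.
have := tri_col b^-1 a^-1 lkj lji; rewrite -invMg !pt_sym //.
by rewrite colC.
Qed.

Section InFlat.
Variable X : {set dowling_pt r G}.
Hypothesis fX : flat Q X.

Lemma flat_edge i j c : i != j -> inl i \in X -> inl j \in X -> pt i j c \in X.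
Proof. by move=> ne iX jX; apply: flat_col (edge_colS c ne) _ iX jX. Qed.

Lemma flat_end i j c : i != j -> inl i \in X -> pt i j c \in X -> inl j \in X.
Proof.
move=> ne iX pX; have := edge_colS c ne; rewrite colCA => h.
by apply: flat_col h _ iX pX => //; rewrite eq_sym pt_neq_inl.
Qed.

(** Both points lie on the line through b_i and b_j, and two points span that line. *)
Lemma flat_vertex i j a b : i != j -> a != b ->
  pt i j a \in X -> pt i j b \in X -> inl i \in X.
Proof.
move=> ne nab aX bX; have nE : inl i != inl j :> dowling_pt r G by [].
have /andP[fL /eqP rL] := line_cl2 sQ nE.
have sL := subsetP (sub_cl Q [set inl i; inl j]).
have iL := sL _ (set21 _ _); have jL := sL _ (set22 _ _).
have inL c := flat_col sQ fL (edge_colS c ne) nE iL jL.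
apply: (flat_col sQ fX _ _ aX bX).
  by apply: (col_rk fL); rewrite ?rL ?inL.
by rewrite (inj_eq (pt_inj ne)).
Qed.

Lemma flat_tri i j k a b : i != j -> j != k -> i != k ->
  pt i j a \in X -> pt j k b \in X -> pt i k (a * b) \in X.
Proof.
move=> nij njk nik aX bX.
by apply: (flat_col sQ fX (tri_colS a b nij njk nik)) => //; apply: pt_neq3.
Qed.

Lemma flat_all : (forall i, inl i \in X) -> X = setT.
Proof.
move=> hX; apply/setP=> x; rewrite inE.
have [[i ->]|[i [j [c [lt [-> _]]]]]] := ptP x; first exact: hX.
by rewrite flat_edge // neq_ltn lt.
Qed.

End InFlat.

(** * Flats given by a colouring and a potential *)

Section Coloured.
Variable C : finType.
Implicit Types (K : 'I_r -> option C).

(* Colour [None] marks the support of the large flat; each other colour class *)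
(* is the support of a small flat with potential [p], so that its elements    *)
(* are the (p_i^-1 p_j)_(i,j).                                                *)
Definition cflat_of K p : {set dowling_pt r G} :=
  [set x | match x with
    | inl i => K i == None
    | inr (c, ij) => let: (i, j) := val ij in
        (K i == K j) && ((K i == None) || (c == (p i)^-1 * p j))
    end].

Lemma mem_inl K p i : (inl i \in cflat_of K p) = (K i == None).
Proof. by rewrite inE. Qed.

Lemma mem_pt K p i j c : i != j -> (pt i j c \in cflat_of K p) =
  (K i == K j) && ((K i == None) || (c == (p i)^-1 * p j)).
Proof.
move=> ne; have := ne; rewrite neq_ltn => /orP[] lt; first by rewrite (pt_lt c lt) inE.
rewrite -pt_sym // (pt_lt _ lt) inE /= eq_sym; case: eqP => //= ->.
by rewrite -(inj_eq invg_inj) invgK invMg invgK.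
Qed.

Lemma mem_potential K p i j : i != j -> K i = K j ->
  pt i j ((p i)^-1 * p j) \in cflat_of K p.
Proof. by move=> ne e; rewrite mem_pt // e !eqxx orbT. Qed.

End Coloured.

(** One coloured class [J], with a large flat on its complement. For nonempty [J] these give
    hyperplanes, from which all coloured flats arise by intersection. *)
Definition two_colour J i : option unit := if i \in J then Some tt else None.

Lemma two_colour_None J i : (two_colour J i == None) = (i \notin J).
Proof. by rewrite /two_colour; case: (i \in J). Qed.

Lemma two_colour_eq J i j :
  (two_colour J i == two_colour J j) = ((i \in J) == (j \in J)).
Proof. by rewrite /two_colour; do 2!case: (_ \in J). Qed.

Lemma two_colour_span J p X i : flat Q X -> cflat_of (two_colour J) p \subset X ->
  i \in J -> inl i \in X -> X = setT.
Proof.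
move=> fX sX iJ iX; apply: flat_all => // j.
have [jJ|jJ] := boolP (j \in J); last first.
  by apply: (subsetP sX); rewrite mem_inl two_colour_None.
have [<-//|ne] := eqVneq i j.
apply: (flat_end fX ne iX) (subsetP sX _ (mem_potential p ne _)).
by rewrite /two_colour iJ jJ.
Qed.

(** The b_j outside [J] and a star at [i] inside [J] span the set; together they have at most r - 1
    elements. *)
Lemma rk_two_colour J p i : i \in J -> rk Q (cflat_of (two_colour J) p) < r.
Proof.
move=> iJ; pose A : {set dowling_pt r G} := inl @: ~: J.
pose B := [set pt i j ((p i)^-1 * p j) | j in J :\ i].
have fX := flat_cl Q (A :|: B); set X := cl Q _ in fX.
have sAB := sub_cl Q (A :|: B).
have inX j : j \notin J -> inl j \in X.
  by move=> jJ; apply: (subsetP sAB); rewrite inE imset_f // inE.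
have ptX j : j \in J -> i != j -> pt i j ((p i)^-1 * p j) \in X.
  move=> jJ ne; apply: (subsetP sAB); rewrite inE; apply/orP; right.
  by apply/imsetP; exists j; rewrite // !inE eq_sym ne.
have sX : cflat_of (two_colour J) p \subset X.
  apply/subsetP=> x; have [[j ->]|[j [k [c [lt [-> _]]]]]] := ptP x.
    by rewrite mem_inl two_colour_None; apply: inX.
  have ne : j != k by rewrite neq_ltn lt.
  rewrite mem_pt // two_colour_eq two_colour_None => /andP[/eqP e].
  case/orP=> [jJ|/eqP ->]; first by apply: flat_edge; rewrite ?inX // -e.
  have [jJ|jJ] := boolP (j \in J); last by apply: flat_edge; rewrite ?inX // -e.
  have kJ : k \in J by rewrite -e.
  have [ek|nij] := eqVneq i k; last first.
    have [<-|nij'] := eqVneq i j; first by apply: ptX; rewrite // -?e.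
    suff -> : (p j)^-1 * p k = ((p i)^-1 * p j)^-1 * ((p i)^-1 * p k).
      have nji : j != i by rewrite eq_sym.
      by apply: (flat_tri fX nji nij ne); rewrite ?pt_sym // ptX.
    by rewrite invMg invgK mulgA mulgK.
  rewrite -ek in ne *.
  by rewrite -(pt_sym _ ne) invMg invgK ptX // eq_sym.
have := rk_sub_cl sX; have := rkU_le Q A B.
have := rk_le_card Q A; have := rk_le_card Q B.
have : #|A| <= #|~: J| by apply: leq_imset_card.
have : #|B| <= #|J :\ i| by apply: leq_imset_card.
have := cardsC J; have := cardsD1 i J; rewrite iJ card_ord; nlia.
Qed.

(** Any further element brings some b_i with i in [J] into the closure, and then everything by
    [two_colour_span]; the rank goes up because it was below r. *)
Lemma flat_two_colour J p : flat Q (cflat_of (two_colour J) p).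
Proof.
apply: flat_rkI => x xF; set F := cflat_of _ _ in xF *.
suff [i iJ iX] : exists2 i, i \in J & inl i \in cl Q (x |: F).
  have fX := flat_cl Q (x |: F).
  have sX : F \subset cl Q (x |: F).
    exact: subset_trans (subsetUr _ _) (sub_cl _ _).
  rewrite -(rk_cl Q (x |: F)) (two_colour_span fX sX iJ iX) -/(mrank Q) rQ.
  exact: rk_two_colour iJ.
have fX := flat_cl Q (x |: F).
have sX := subsetP (sub_cl Q (x |: F)).
have FX y : y \in F -> y \in cl Q (x |: F) by move=> yF; apply: sX; rewrite setU1r.
have : x \in cl Q (x |: F) by apply: sX; rewrite setU11.
move: xF FX fX; rewrite /F; set X := cl Q _.
have [[j ->]|[j [k [c [lt [-> _]]]]]] := ptP x.
  by rewrite mem_inl two_colour_None negbK => jJ *; exists j.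
have ne : j != k by rewrite neq_ltn lt.
have nek : k != j by rewrite eq_sym.
rewrite mem_pt // two_colour_eq two_colour_None => nF FX fX xX.
have notJ l : l \notin J -> inl l \in X.
  by move=> lJ; apply: FX; rewrite mem_inl two_colour_None.
move: nF; have [jJ|jJ] := boolP (j \in J); have [kJ|kJ] := boolP (k \in J) => //= nc.
- exists j => //; apply: (flat_vertex fX ne nc xX); apply: FX.
  by apply: mem_potential; rewrite // /two_colour jJ kJ.
- by exists j => //; apply: (flat_end fX nek (notJ k kJ) (_ : pt k j c^-1 \in X)); rewrite pt_sym.
by exists k => //; apply: (flat_end fX ne (notJ j jJ) xX).
Qed.

Section Coloured.
Variable C : finType.
Implicit Types (K : 'I_r -> option C).

(** The set is the intersection, over the colours u, of the two-colour flats that single out the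
    class of u. *)
Lemma flat_cflat_of K p : flat Q (cflat_of K p).
Proof.
pose J (u : C) := [set i | K i == Some u].
suff -> : cflat_of K p = \bigcap_(u : C) cflat_of (two_colour (J u)) p.
  by apply: flat_bigcap => u _; apply: flat_two_colour.
apply/setP=> x; apply/idP/bigcapP=> [xF u _|xF].
  move: xF; have [[j ->]|[j [k [c [lt [-> _]]]]]] := ptP x.
    by rewrite !mem_inl two_colour_None inE => /eqP->.
  have ne : j != k by rewrite neq_ltn lt.
  rewrite !mem_pt // two_colour_eq two_colour_None !inE => /andP[/eqP-> ].
  by rewrite eqxx; case/orP => /eqP->; rewrite ?eqxx ?orbT.
move: xF; have [[j ->]|[j [k [c [lt [-> _]]]]]] := ptP x => xF.
  rewrite mem_inl; case e: (K j) => [u|] //.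
  by have := xF u isT; rewrite mem_inl two_colour_None inE e eqxx.
have ne : j != k by rewrite neq_ltn lt.
have {}xF u := xF u isT; rewrite mem_pt //.
have H u : ((K j == Some u) == (K k == Some u)) &&
    ((K j != Some u) || (c == (p j)^-1 * p k)).
  by have := xF u; rewrite mem_pt // two_colour_eq two_colour_None !inE.
case e: (K j) => [u|]; case e': (K k) => [v|] //=.
- have /andP[/eqP h1 h2] := H u; move: h1 h2; rewrite e e' eqxx => /esym/eqP[->].
  by rewrite eqxx.
- by have := H u; rewrite e e' eqxx.
by have := H v; rewrite e e' eqxx.
Qed.

Definition used K : {set C} := [set u | [exists i, K i == Some u]].

(** Erasing one colour raises the rank by exactly one: the smaller set is a flat properly contained
    in the new one, and adding a single b_i of the erased class spans the new one. *)
Lemma rk_cflat_of K p : rk Q (cflat_of K p) + #|used K| = r.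
Proof.
have [n] := ubnP #|used K|; elim: n K => // n IHn K ltK.
have [e0|[u]] := set_0Vmem (used K).
  suff -> : cflat_of K p = setT by rewrite e0 cards0 addn0.
  apply: (flat_all (flat_cflat_of K p)) => i; rewrite mem_inl.
  case e: (K i) => [u|] //; have : u \in used K.
    by rewrite inE; apply/existsP; exists i; rewrite e.
  by rewrite e0 inE.
move=> uK; have := uK; rewrite inE => /existsP[i /eqP iu].
pose K' j := if K j == Some u then None else K j.
have eU : used K' = used K :\ u.
  apply/setP=> v; rewrite !inE; apply/existsP/andP=> [[j]|[nv /existsP[j /eqP ej]]].
    rewrite /K'; case: (K j =P Some u) => // nj /eqP ej; split; last by apply/existsP; exists j; rewrite ej.
    by apply/eqP=> e; rewrite ej e in nj.
  by exists j; rewrite /K' ej (inj_eq Some_inj) (negPf nv).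
have cU := cardsD1 u (used K); rewrite uK in cU.
have := IHn K'; rewrite eU => /(_ ltac:(nlia)) IH.
suff : rk Q (cflat_of K' p) = (rk Q (cflat_of K p)).+1 by nlia.
apply/eqP; rewrite eqn_leq; apply/andP; split; last first.
  apply: (flat_ltn (flat_cflat_of K p)); apply/properP; split; last first.
    by exists (inl i); rewrite mem_inl /K' iu ?eqxx.
  apply/subsetP=> x; have [[j ->]|[j [k [c [lt [-> _]]]]]] := ptP x.
    by rewrite !mem_inl /K' => /eqP->.
  have ne : j != k by rewrite neq_ltn lt.
  rewrite !mem_pt // /K' => /andP[/eqP-> h]; rewrite eqxx /=.
  by case: ifP.
apply: leq_trans (rkU1_le Q (inl i) _); apply: rk_sub_cl.
have fX := flat_cl Q (inl i |: cflat_of K p); set X := cl Q _ in fX *.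
have sX := subsetP (sub_cl Q (inl i |: cflat_of K p)).
have inX j : K' j == None -> inl j \in X.
  rewrite /K'; case: (K j =P Some u) => [eu _|_ ej]; last by rewrite sX // !inE ej orbT.
  have iX : inl i \in X by rewrite sX // setU11.
  have [<-//|ne] := eqVneq i j; apply: (flat_end fX ne iX).
  by apply: sX; apply: setU1r; apply: (mem_potential p ne); rewrite iu.
apply/subsetP=> x; have [[j ->]|[j [k [c [lt [-> _]]]]]] := ptP x.
  by rewrite mem_inl; apply: inX.
have ne : j != k by rewrite neq_ltn lt.
rewrite mem_pt // => /andP[/eqP e h].
have [/eqP e'|nn] := boolP (K' j == None).
  by apply: flat_edge; rewrite ?inX -?e ?e'.
rewrite (negPf nn) /= in h; apply: sX; apply: setU1r; rewrite mem_pt // h orbT andbT.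
move: e nn; rewrite /K'; case: (K j =P _) => // _; case: (K k =P _) => [_ -> //|_ ->].
by rewrite eqxx.
Qed.

End Coloured.

(** * Every flat comes from a colouring and a potential *)

Section ColourOfFlat.
Variable X : {set dowling_pt r G}.
Hypothesis fX : flat Q X.

Definition joined i j := (i == j) || [exists c, pt i j c \in X].

Definition colour i : option {set 'I_r} :=
  if inl i \in X then None else Some [set j | joined i j].

(* The potential of a class is normalised to 1 at the representative that     *)
(* [pick] selects: there [pt j j c] is the point [inl j], which is not in [X]. *)
Definition potential i : G :=
  odflt 1 (if [pick j | joined i j] is Some j then [pick c | pt j i c \in X]
           else None).

Lemma joinedP i j : i != j -> reflect (exists c, pt i j c \in X) (joined i j).
Proof. by rewrite /joined => /negPf->; apply: existsP. Qed.

Lemma joined_sym i j : joined i j = joined j i.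
Proof.
have [-> //|ne] := eqVneq i j; have ne' : j != i by rewrite eq_sym.
by apply/joinedP/joinedP => // -[c cX]; exists c^-1; rewrite pt_sym.
Qed.

Lemma joined_trans i j k : joined i j -> joined j k -> joined i k.
Proof.
have [-> //|nij] := eqVneq i j; have [-> //|njk] := eqVneq j k.
have [-> _ _|nik] := eqVneq i k; first by rewrite /joined eqxx.
move=> /(joinedP nij)[a aX] /(joinedP njk)[b bX].
by apply/joinedP => //; exists (a * b); apply: flat_tri aX bX.
Qed.

Lemma joined_class i j : joined i j -> joined i =1 joined j.
Proof.
move=> ij k; apply/idP/idP; last exact: joined_trans.
by apply: joined_trans; rewrite joined_sym.
Qed.

Lemma joined_inl i j : joined i j -> (inl i \in X) = (inl j \in X).
Proof.
have [-> //|ne] := eqVneq i j; have ne' : j != i by rewrite eq_sym.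
move=> /(joinedP ne)[c cX]; apply/idP/idP; first by move/flat_end; apply; eauto.
by move=> jX; apply: (flat_end fX ne' jX (_ : pt j i c^-1 \in X)); rewrite pt_sym.
Qed.

Lemma potentialP i j : joined i j -> i != j -> inl i \notin X ->
  pt i j ((potential i)^-1 * potential j) \in X.
Proof.
move=> ij ne iX; rewrite /potential -(eq_pick (joined_class ij)).
case: pickP => [k ik|/(_ i)]; last by rewrite /joined eqxx.
have kX : inl k \notin X by rewrite -(joined_inl ik).
have jX : inl j \notin X by rewrite -(joined_inl ij).
have kj : joined k j by rewrite -(joined_class ik).
have one : odflt 1 [pick c | pt k k c \in X] = 1.
  by case: pickP => // c; rewrite /pt insubF ?ltnn //= (negPf kX).
have pick l : joined k l -> k != l -> pt k l (odflt 1 [pick c | pt k l c \in X]) \in X.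
  by move=> kl nkl; have [c cX] := joinedP nkl kl; case: pickP => [//|/(_ c)]; rewrite cX.
have [eki|nki] := eqVneq k i.
  by move: one pick; rewrite eki => -> pick; rewrite invg1 mul1g; apply: pick.
have nik : i != k by rewrite eq_sym.
have [ekj|nkj] := eqVneq k j.
  move: one pick; rewrite ekj => -> pick; rewrite mulg1 pt_inv //.
  by apply: pick; rewrite 1?joined_sym // eq_sym.
apply: (flat_tri fX nik nkj ne); last exact: pick.
by rewrite pt_inv //; apply: pick; rewrite // joined_sym.
Qed.

(** A point of [X] over i, j that disagreed with the potential would be a second point on that side,
    and [flat_vertex] would put b_i into [X]. *)
Lemma flat_colouring : X = cflat_of colour potential.
Proof.
apply/setP=> x; have [[j ->]|[i [j [c [lt [-> _]]]]]] := ptP x.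
  by rewrite mem_inl /colour; case: ifP.
have ne : i != j by rewrite neq_ltn lt.
rewrite mem_pt // /colour; apply/idP/idP => [cX|].
  have ij : joined i j by apply/joinedP => //; exists c.
  rewrite -(joined_inl ij); case: ifPn => //= iX; apply/andP; split.
    by apply/eqP; congr Some; apply/setP=> k; rewrite !inE; apply: joined_class.
  apply: contraT => nc.
  by have := flat_vertex fX ne nc cX (potentialP ij ne iX); rewrite (negPf iX).
case: ifP => iX; case: ifP => jX //=; first by move=> _; apply: flat_edge.
case/andP=> /eqP[] /setP/(_ j); rewrite !inE [joined j j]/joined eqxx => ij /eqP->.
by apply: potentialP; rewrite ?iX.
Qed.

Lemma colour_class i J : colour i = Some J -> J = [set j | colour j == Some J].
Proof.
rewrite /colour; case: ifPn => // iX [<-]; apply/setP=> j; rewrite !inE.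
apply/idP/idP => [ij|].
  rewrite -(joined_inl ij) (negPf iX); apply/eqP; congr Some.
  by apply/setP=> k; rewrite !inE; apply/esym/joined_class.
case: ifP => // _ /eqP[] /setP/(_ j); rewrite !inE => <-.
by rewrite /joined eqxx.
Qed.

End ColourOfFlat.

(** Each colour is literally the class that carries it, so colours can serve as supports of small
    flats, and [set0] is always a fresh colour. *)
Definition class_colouring (K : 'I_r -> option {set 'I_r}) :=
  forall i J, K i = Some J -> J = [set j | K j == Some J].

Lemma class_colouring_mem K i J : class_colouring K -> K i = Some J -> i \in J.
Proof. by move=> cK e; rewrite (cK _ _ e) inE e. Qed.

(* Recolouring [i] with the unused colour [set0] deletes exactly the elements *)
(* whose support contains [i]. *)
Lemma flat_delete (K : 'I_r -> option {set 'I_r}) p i x : class_colouring K ->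
  i \in sup x -> (forall y, y \in cflat_of K p -> i \in sup y -> y = x) ->
  flat Q (cflat_of K p :\ x).
Proof.
move=> cK ix uniq_x; pose K' j := if j == i then Some set0 else K j.
have K0 j : K j == Some set0 = false.
  by apply/eqP=> e; have := class_colouring_mem cK e; rewrite inE.
suff -> : cflat_of K p :\ x = cflat_of K' p by apply: flat_cflat_of.
apply/setP=> y; rewrite in_setD1.
have [iy|iy] := boolP (i \in sup y).
  have -> : (y != x) && (y \in cflat_of K p) = false.
    by apply/andP=> -[/eqP ne yF]; apply: ne; apply: uniq_x.
  move: iy; have [[j ->]|[j [k [c [lt [-> _]]]]]] := ptP y.
    by rewrite mem_inl /K' inE => /eqP->; rewrite eqxx.
  have ne : j != k by rewrite neq_ltn lt.
  rewrite sup_pt // mem_pt // /K' !inE => /orP[] /eqP e; move: ne; rewrite -e eqxx => ne.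
    by rewrite [k == _]eq_sym (negPf ne) eq_sym K0.
  by rewrite (negPf ne) K0.
have -> : y != x by apply: contraNneq iy => ->.
move: iy; have [[j ->]|[j [k [c [lt [-> _]]]]]] := ptP y.
  by rewrite !mem_inl /K' inE [i == j]eq_sym => /negPf->.
have ne : j != k by rewrite neq_ltn lt.
rewrite sup_pt // !mem_pt // /K' !inE negb_or ![i == _]eq_sym.
by case/andP=> /negPf-> /negPf->.
Qed.

Definition classes (K : 'I_r -> option {set 'I_r}) : {set {set 'I_r}} :=
  [set J in used K | 3 <= #|J|].

(** In r minus the number of colours, a class [J] accounts for [#|J|] indices and one colour.
    Singleton classes contribute 0, so only those in [classes] remain. *)
Lemma rk_classes K p : class_colouring K -> (forall i J, K i = Some J -> #|J| != 2%N) ->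
  rk Q (cflat_of K p) =
  (#|[set i | K i == None]| + \sum_(J in classes K) (#|J| - 1))%N.
Proof.
move=> cK n2; have := rk_cflat_of K p.
have mem_used i J : K i = Some J -> J \in used K.
  by move=> e; rewrite inE; apply/existsP; exists i; rewrite e.
have used_class J : J \in used K -> J = [set j | K j == Some J].
  by rewrite inE => /existsP[i /eqP /cK].
have -> : (\sum_(J in classes K) (#|J| - 1) = \sum_(J in used K) (#|J| - 1))%N.
  rewrite [RHS](bigID (fun J : {set 'I_r} => 3 <= #|J|)) /=.
  rewrite [X in (_ + X)%N]big1 ?addn0 => [|J /andP[uJ]].
    by apply: eq_bigl => J; rewrite inE.
  rewrite -ltnNge; have := uJ; rewrite inE => /existsP[i /eqP /n2].
  by case: #|J| => [|[|[|m]]].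
have : \sum_(J in used K) #|J| = #|[set i | K i != None]|.
  rewrite -[RHS]sum1_card (partition_big (fun i => odflt set0 (K i)) (mem (used K))).
    apply: eq_bigr => J uJ; rewrite [in LHS](used_class J uJ) -sum1_card.
    apply: eq_bigl => i; rewrite !inE; case e: (K i) => [J'|//].
    by rewrite /= (inj_eq Some_inj).
  by move=> i; rewrite inE; case e: (K i) => [J|//] _; apply: mem_used e.
have -> : \sum_(J in used K) #|J| = (\sum_(J in used K) (#|J| - 1) + #|used K|)%N.
  rewrite -sum1_card -big_split; apply: eq_bigr => J uJ /=.
  have := uJ; rewrite inE => /existsP[i /eqP e].
  have : 0 < #|J| by apply/card_gt0P; exists i; apply: class_colouring_mem e.
  by case: #|J| => // m _; rewrite subn1 addn1.
have := cardsC [set i | K i == None]; rewrite card_ord.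
have -> : ~: [set i | K i == None] = [set i | K i != None].
  by apply/setP=> i; rewrite !inE.
by move=> h1 h2 h3; lia.
Qed.

Lemma cyclic_flatI F : flat Q F ->
  (forall x, x \in F -> exists2 C, circuit Q C & (C \subset F) && (x \in C)) ->
  cyclic_flat Q F.
Proof.
move=> fF hF; rewrite /cyclic_flat fF /= eqEsubset; apply/andP; split.
  apply/subsetP=> x /hF[C cC /andP[sC xC]]; apply/bigcupP; exists C => //.
  by rewrite inE cC.
by apply/bigcupsP=> C; rewrite inE => /andP[].
Qed.

Lemma edge_circuit i j c : i != j -> circuit Q [set inl i; inl j; pt i j c].
Proof.
move=> ne; apply: circuit3 => //; last exact: edge_colS.
by rewrite card3 // eq_sym pt_neq_inl.
Qed.

Lemma tri_circuit i j k a b : i != j -> j != k -> i != k ->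
  circuit Q [set pt i j a; pt j k b; pt i k (a * b)].
Proof.
move=> nij njk nik; apply: circuit3 => //; last exact: tri_colS.
have nji : j != i by rewrite eq_sym.
have nki : k != i by rewrite eq_sym.
rewrite card3 //; first exact: pt_neq3.
  by rewrite -(pt_sym a nij); apply: pt_neq3.
by rewrite -(pt_sym (a * b) nik); apply: pt_neq3.
Qed.

(** A class of two indices, or a large part on a single index, would give the flat a coloop. In a
    union of large and small parts, every element lies in a three-element circuit. *)
Lemma dowling_flats : is_dowling Q.
Proof.
split=> // X n; split.
  case=> cX <-; have /andP[fX _] := cX.
  pose K := colour X; pose p := potential X.
  have eX : X = cflat_of K p := flat_colouring fX.
  have cK : class_colouring K by move=> i J; apply: colour_class.
  have no_coloop x i : i \in sup x -> x \in X ->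
      (forall y, y \in X -> i \in sup y -> y = x) -> False.
    rewrite eX => ix xX ux.
    by have := coloop_not_cyclic (flat_delete cK ix ux) xX; rewrite -eX cX.
  have K2 i J : K i = Some J -> #|J| != 2%N.
    move=> e; apply/eqP=> J2; have iJ := class_colouring_mem cK e.
    have [|j jJ] := @ltn_card_exists _ [set i] J; first by rewrite cards1 J2.
    rewrite inE eq_sym => ne.
    have ej : K j = Some J by move: jJ; rewrite {1}(cK _ _ e) inE => /eqP.
    have eJ : J = [set i; j].
      apply/esym/eqP; rewrite eqEcard subUset !sub1set iJ jJ.
      by rewrite cards2 ne J2.
    (* In a two-element class this is the only element of [X] whose support contains [i]. *)
    apply: (no_coloop (pt i j ((p i)^-1 * p j)) i).
    - by rewrite sup_pt // set21.
    - by rewrite {1}eX; apply: mem_potential; rewrite ?e.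
    move=> y; rewrite {1}eX; have [[k ->]|[k [l [c [lt [-> _]]]]]] := ptP y.
      by rewrite mem_inl inE => + /eqP ik; rewrite -ik e.
    have nkl : k != l by rewrite neq_ltn lt.
    rewrite mem_pt // sup_pt // !inE => /andP[/eqP ekl h] /orP[]/eqP ik.
      move: ekl h nkl; rewrite -ik e /= => el /eqP-> nil.
      suff -> : j = l by [].
      have : l \in J by rewrite (cK _ _ e) inE -el.
      by rewrite eJ !inE eq_sym (negPf nil) => /eqP.
    move: ekl h nkl; rewrite -ik e /= => ek; rewrite ek /= => /eqP-> nki.
    have -> : k = j.
      have : k \in J by rewrite (cK _ _ e) inE ek.
      by rewrite eJ !inE (negPf nki) => /eqP.
    have nji : j != i by rewrite eq_sym.
    by rewrite -(pt_sym _ nji) invMg invgK.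
  pose I := [set i | K i == None].
  have memI i : (inl i \in X) = (i \in I) by rewrite {1}eX mem_inl inE.
  have I1 : #|I| != 1%N.
    apply/cards1P=> -[i eI]; apply: (no_coloop (inl i) i); rewrite ?memI ?eI ?set11 //.
    move=> y; rewrite {1}eX; have [[k ->]|[k [l [c [lt [-> _]]]]]] := ptP y.
      by rewrite inE => _ /set1P->.
    have nkl : k != l by rewrite neq_ltn lt.
    have iN : K i = None by have := set11 i; rewrite -eI inE => /eqP.
    have uN k' : K k' = None -> k' = i.
      by move=> ek; apply/set1P; rewrite -eI inE ek.
    rewrite mem_pt // sup_pt // !inE => /andP[/eqP ekl _] /orP[]/eqP ik.
      by move: nkl; rewrite -ik (uN l) ?eqxx // -ekl -ik.
    by move: nkl; rewrite -ik (uN k) ?eqxx // ekl -ik.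
  (* The least element of [J]; [i] is the witness that the minimum asks for, and by [mE] the value
     is the same for all [i] in [J]. *)
  pose m (J : {set 'I_r}) i := [arg min_(k < i in J) val k].
  have mE J i j : i \in J -> j \in J -> m J i = m J j.
    rewrite /m => iJ jJ; case: arg_minnP => // k kJ hk; case: arg_minnP => // l lJ hl.
    by apply: val_inj; apply/eqP; rewrite eqn_leq hk // hl.
  have used_class J : [exists i, K i == Some J] -> J = [set j | K j == Some J].
    by case/existsP=> i /eqP /cK.
  (* [small_flat] treats the value at the least index of [J] as 1, so the potential is normalised
     there. *)
  exists I, (classes K), (fun J j => (p (m J j))^-1 * p j); split.
  - have [->|] := eqVneq I set0; [by left|rewrite -cards_eq0 => I0; right].
    by nlia.
  - apply/trivIsetP=> A B; rewrite !inE => /andP[uA _] /andP[uB _].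
    have {}uA := used_class A uA; have {}uB := used_class B uB.
    apply: contraNT => /pred0Pn[i /= /andP[]]; rewrite uA uB !inE -uA -uB.
    by move=> /eqP-> /eqP[->].
  - move=> J; rewrite !inE => /andP[uJ J3]; split=> //.
    apply/pred0Pn=> -[i /= /andP[]].
    by have {}uJ := used_class J uJ; rewrite uJ !inE => /eqP->.
  - apply/setP=> x; rewrite inE; rewrite {1}eX.
    have [[i ->]|[i [j [c [lt [-> ept]]]]]] := ptP x.
      rewrite mem_inl !inE; apply/esym/orb_idr => /bigcupP[J _].
      by rewrite inE.
    have ne : i != j by rewrite neq_ltn lt.
    rewrite mem_pt //; move: (ept); rewrite -(pt_lt c lt) => _; rewrite (pt_lt c lt).
    have sfE J : i \in J -> j \in J ->
        (c == if [forall k in J, i <= k] then (p (m J j))^-1 * p j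
         else ((p (m J i))^-1 * p i)^-1 * ((p (m J j))^-1 * p j)) =
        (c == (p i)^-1 * p j).
      move=> iJ jJ; rewrite (mE J j i) //; case: ifP => [/forall_inP minI|_].
        suff -> : m J i = i by [].
        rewrite /m; case: arg_minnP => // k kJ hk.
        by apply: val_inj; apply/eqP; rewrite eqn_leq hk // minI.
      by rewrite invMg invgK mulgA mulgK.
    apply/idP/orP=> [/andP[/eqP eK h]|[]].
    + move: h; case eKi: (K i) => [J|] /= h; last first.
        by left; rewrite inE /= !inE -eK eKi.
      have iJ := class_colouring_mem cK eKi.
      have jJ : j \in J by apply: (class_colouring_mem cK); rewrite -eK.
      right; apply/bigcupP; exists J; last by rewrite inE /= iJ jJ sfE.
      rewrite !inE; apply/andP; split; first by apply/existsP; exists i; rewrite eKi.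
      rewrite ltn_neqAle eq_sym (K2 i) //=.
      by apply/card_gt1P; exists i, j.
    + by rewrite inE /= !inE => /andP[/eqP-> /eqP->].
    case/bigcupP=> J; rewrite !inE /= => /andP[uJ _] /and3P[iJ jJ].
    have {}uJ := used_class J uJ; rewrite sfE // => ->.
    by move: iJ jJ; rewrite uJ !inE => /eqP-> /eqP->; rewrite eqxx orbT.
  by rewrite {1}eX rk_classes.
case=> I [P [a [I2 tP hP -> ->]]].
(* [pblock P i] is empty when [i] is in no block, and such an [i] becomes a class of its own. The
   potential is 1 at the least index of a block, as in [small_flat]. *)
pose K i := if i \in I then None else Some (i |: pblock P i).
pose p i := if [forall k in pblock P i, i <= k] then 1 else a (pblock P i) i.
have pbE J i : J \in P -> i \in J -> pblock P i = J.
  by move=> JP iJ; apply: def_pblock.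
have pb0 i : i \notin cover P -> pblock P i = set0.
  rewrite /pblock; case: pickP => //= J /andP[JP iJ] /bigcupP[].
  by exists J.
have KP J i : J \in P -> i \in J -> K i = Some J.
  move=> JP iJ; have [_ /pred0P/(_ i)/= dJ] := hP J JP.
  rewrite /K; case: ifP => iI; first by rewrite iI iJ in dJ.
  by rewrite (pbE J) // (setUidPr _) ?sub1set.
have K_eq i j : i \notin I -> K i = K j -> i != j -> exists2 J, J \in P & (i \in J) && (j \in J).
  rewrite /K => /negPf->; case: ifP => // _ [e] ne.
  have ci : i \in cover P.
    apply: contraNT ne => /pb0 e0; rewrite eq_sym -in_set1.
    have : j \in i |: pblock P i by rewrite e setU11.
    by move: (e0) => ->; rewrite setU0.
  exists (pblock P i); first exact: pblock_mem.
  have iJ : i \in pblock P i by rewrite mem_pblock.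
  rewrite iJ /=; have : j \in i |: pblock P i by rewrite e setU11.
  by rewrite (setUidPr _) ?sub1set.
have cK : class_colouring K.
  move=> i J; rewrite /K; case: ifPn => // iI [<-]; apply/setP=> j; rewrite [in RHS]inE.
  apply/idP/idP.
    case/setU1P=> [->|ji]; first by rewrite (negPf iI).
    have ci : i \in cover P.
      by apply: contraLR ji => /pb0->; rewrite inE.
    have JP := pblock_mem ci; have iJ : i \in pblock P i by rewrite mem_pblock.
    by rewrite -/(K j) (KP _ _ JP ji) (setUidPr _) ?sub1set.
  by case: ifP => // _ /eqP[<-]; rewrite setU11.
have KI : [set i | K i == None] = I.
  by apply/setP=> i; rewrite inE /K; case: ifP.
have clP : classes K = P.
  apply/setP=> J; rewrite !inE; apply/andP/idP => [[/existsP[i /eqP eJ] J3]|JP].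
    have iJ := class_colouring_mem cK eJ.
    have [|j jJ] := @ltn_card_exists _ [set i] J; first by rewrite cards1 ltnW.
    rewrite inE eq_sym => ne; have ej : K j = Some J.
      by move: jJ; rewrite {1}(cK _ _ eJ) inE => /eqP.
    have iI : i \notin I by apply: contraT; rewrite negbK /K in eJ * => iI; rewrite iI in eJ.
    have [J' J'P /andP[iJ' _]] := K_eq i j iI (etrans eJ (esym ej)) ne.
    by move: eJ; rewrite (KP _ _ J'P iJ') => -[<-].
  have [J3 _] := hP J JP; split=> //; have /card_gt0P[i iJ] : 0 < #|J| by nlia.
  by apply/existsP; exists i; rewrite (KP J).
have K2 i J : K i = Some J -> #|J| != 2%N.
  move=> eJ; apply/eqP=> J2; have iJ := class_colouring_mem cK eJ.
  have [|j jJ] := @ltn_card_exists _ [set i] J; first by rewrite cards1 J2.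
  rewrite inE eq_sym => ne; have ej : K j = Some J.
    by move: jJ; rewrite {1}(cK _ _ eJ) inE => /eqP.
  have iI : i \notin I by rewrite -KI inE eJ.
  have [J' J'P /andP[iJ' _]] := K_eq i j iI (etrans eJ (esym ej)) ne.
  move: eJ; rewrite (KP _ _ J'P iJ') => -[eJ].
  by have [] := hP _ J'P; rewrite eJ J2.
have -> : large_flat G I :|: \bigcup_(J in P) small_flat J (a J) = cflat_of K p.
  apply/setP=> x; rewrite in_setU.
  have [[i ->]|[i [j [c [lt [-> ept]]]]]] := ptP x.
    rewrite mem_inl; have -> : (K i == None) = (i \in I) by rewrite -KI inE.
    rewrite [inl i \in large_flat _ _]inE; apply/orb_idr => /bigcupP[J _].
    by rewrite inE.
  have ne : i != j by rewrite neq_ltn lt.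
  rewrite mem_pt // (pt_lt c lt).
  have sfE J : J \in P -> i \in J -> j \in J ->
      (c == if [forall k in J, i <= k] then a J j else (a J i)^-1 * a J j) =
      (c == (p i)^-1 * p j).
    move=> JP iJ jJ; rewrite /p !(pbE J) //.
    have -> : [forall k in J, j <= k] = false.
      by apply/negP=> /forall_inP/(_ i iJ); rewrite leqNgt lt.
    by case: ifP => // _; rewrite invg1 mul1g.
  apply/orP/andP=> [[]|[/eqP eK h]].
  - rewrite inE /= => /andP[iI jI].
    by rewrite /K iI jI.
  - case/bigcupP=> J JP; rewrite inE /= => /and3P[iJ jJ].
    by rewrite sfE // !(KP J) // eqxx => ->.
  have [iI|iI] := boolP (i \in I).
    left; rewrite inE /= iI -KI inE -eK.
    by move: iI; rewrite -KI inE.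
  have [J JP /andP[iJ jJ]] := K_eq i j iI eK ne.
  right; apply/bigcupP; exists J => //; rewrite inE /= iJ jJ sfE //.
  by move: h; rewrite (KP J).
split; last by rewrite rk_classes // KI clP.
have sub3 x y z : x \in cflat_of K p -> y \in cflat_of K p -> z \in cflat_of K p ->
    [set x; y; z] \subset cflat_of K p.
  by move=> xF yF zF; rewrite !subUset !sub1set xF yF.
have memI i : (inl i \in cflat_of K p) = (i \in I).
  by rewrite mem_inl -KI inE.
have ptI i j c : i \in I -> j \in I -> i != j -> pt i j c \in cflat_of K p.
  by move=> iI jI ne; rewrite mem_pt //; move: iI jI; rewrite -KI !inE => /eqP-> /eqP->.
apply: cyclic_flatI => [|x]; first exact: flat_cflat_of.
have [[i ->]|[i [j [c [lt [-> _]]]]]] := ptP x => xF.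
  have iI : i \in I by rewrite -memI.
  have [|j jI] := @ltn_card_exists _ [set i] I.
    by rewrite cards1; case: I2 iI => // ->; rewrite inE.
  rewrite inE eq_sym => ne; exists [set inl i; inl j; pt i j 1]; first exact: edge_circuit.
  by rewrite sub3 ?memI ?ptI //= !inE eqxx.
have ne : i != j by rewrite neq_ltn lt.
have := xF; rewrite mem_pt // => /andP[/eqP eK h].
have [iI|iI] := boolP (i \in I).
  have jI : j \in I by move: iI; rewrite -KI !inE eK.
  exists [set inl i; inl j; pt i j c]; first exact: edge_circuit.
  by rewrite sub3 ?memI ?ptI //= !inE eqxx !orbT.
have [J JP /andP[iJ jJ]] := K_eq i j iI eK ne.
have [J3 _] := hP J JP.
have [|k kJ] := @ltn_card_exists _ [set i; j] J; first by rewrite cards2 ne.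
rewrite !inE negb_or => /andP[nki nkj].
have nik : i != k by rewrite eq_sym.
have eKk l : l \in J -> K l = Some J by apply: KP.
have ec : c = (p i)^-1 * p j by move: h; rewrite eKk //= => /eqP.
have ptJ l l' : l \in J -> l' \in J -> l != l' -> pt l l' ((p l)^-1 * p l') \in cflat_of K p.
  by move=> lJ lJ' nl; apply: mem_potential; rewrite ?eKk.
exists [set pt i k ((p i)^-1 * p k); pt k j ((p k)^-1 * p j);
            pt i j ((p i)^-1 * p k * ((p k)^-1 * p j))]; first exact: tri_circuit.
rewrite mulgA mulgK -ec; apply/andP; split; last by rewrite !inE eqxx !orbT.
by apply: sub3 => //; apply: ptJ.
Qed.

End DowlingFlats.

(** * Transport of a matroid along a labelling *)

Section Pullback.
Variables (E E' : finType) (M : matroid E) (f : E' -> E).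
Hypothesis f_inj : injective f.
Implicit Types (X Y : {set E'}).

Definition pullback : matroid E'.
Proof.
exists (fun X => rk M (f @: X)) => [X|X Y sXY|X Y].
- by rewrite -(card_imset _ f_inj) rk_le_card.
- by rewrite rk_mono // imsetS.
by rewrite imsetU imsetI ?rk_submod //; move=> x y _ _; apply: f_inj.
Defined.

Lemma rk_pullback X : rk pullback X = rk M (f @: X). Proof. by []. Qed.

Lemma simple_pullback : simple_matroid M -> simple_matroid pullback.
Proof.
move=> /simple_matroidP sM; apply/simple_matroidP=> X leX.
by rewrite rk_pullback -(card_imset _ f_inj) sM // card_imset.
Qed.

Lemma col_pullback x y z : col pullback x y z = col M (f x) (f y) (f z).
Proof. by rewrite /col rk_pullback !imsetU !imset_set1. Qed.

Hypothesis f_bij : bijective f.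

Lemma imset_bijT : f @: [set: E'] = [set: E].
Proof.
have [h fK hK] := f_bij; apply/setP=> x; rewrite inE; apply/imsetP.
by exists (h x); rewrite ?hK.
Qed.

Lemma mrank_pullback : mrank pullback = mrank M.
Proof. by rewrite /mrank rk_pullback imset_bijT. Qed.

Lemma pullback_iso : isomorphic pullback M.
Proof. by exists f. Qed.

Lemma line_pullback X : line pullback X = line M (f @: X).
Proof.
have [h fK hK] := f_bij; rewrite /line rk_pullback; congr andb.
apply/eqP/eqP => /setP eX; apply/setP=> x.
  have := eX (h x); rewrite inE rk_pullback imsetU1 hK inE => ->.
  by rewrite -{2}[x]hK mem_imset.
by have := eX (f x); rewrite mem_imset // !inE rk_pullback imsetU1.
Qed.

End Pullback.

(** * Supports and three-point lines *)

Section Frame.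
Variables (g r : nat) (hg : 2 <= g).
Variables (E : finType) (M : matroid E).
Hypothesis sM : simple_matroid M.
Hypothesis hcard : #|E| = r + g * 'C(r, 2).
(* [supp x] is the set of i such that x is not in the i-th large hyperplane, so *)
(* that [cflat T] is the meet of the large hyperplanes with index outside T. *)
Variable supp : E -> {set 'I_r}.

Definition cflat (T : {set 'I_r}) : {set E} := [set x | supp x \subset T].

Hypothesis cflat_large : forall T, large_rk g M (cflat T) #|T|.

Implicit Types (T U P Q : {set 'I_r}) (x y z : E) (i j k : 'I_r) (L : {set E}).

Lemma flat_cflat T : flat M (cflat T).
Proof. by have /large_rkP[] := cflat_large T. Qed.

Lemma card_cflat T : #|cflat T| = lsize g #|T|.
Proof. by have /large_rkP[] := cflat_large T. Qed.

Lemma rk_cflat T : rk M (cflat T) = #|T|.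
Proof. by have /large_rkP[] := cflat_large T. Qed.

Lemma mem_cflat T x : (x \in cflat T) = (supp x \subset T).
Proof. by rewrite inE. Qed.

Lemma sub_cflat (X : {set E}) T :
  (forall x, x \in X -> supp x \subset T) -> X \subset cflat T.
Proof. by move=> sX; apply/subsetP=> x /sX; rewrite inE. Qed.

Lemma supp_neq0 x : supp x != set0.
Proof.
apply/eqP=> e; have := card_cflat set0.
rewrite cards0 lsize_small => /cards0_eq/setP/(_ x).
by rewrite !inE e subxx.
Qed.

Definition fiber T : {set E} := [set x | supp x == T].

Lemma card_fiber1 i : #|fiber [set i]| = 1.
Proof.
rewrite -[RHS](lsize_small g).1.1.1.2 -(cards1 i) -card_cflat; apply: eq_card => x.
by rewrite !inE subset1 (negPf (supp_neq0 x)) orbF.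
Qed.

Lemma vert_ex i : exists x, supp x == [set i].
Proof.
have /card_gt0P[x] : 0 < #|fiber [set i]| by rewrite card_fiber1.
by rewrite inE; exists x.
Qed.

Definition vert i := xchoose (vert_ex i).

Lemma supp_vert i : supp (vert i) = [set i].
Proof. exact/eqP/(xchooseP (vert_ex i)). Qed.

Lemma fiber1 i : fiber [set i] = [set vert i].
Proof.
apply/esym/eqP; rewrite eqEcard sub1set inE supp_vert eqxx.
by rewrite cards1 card_fiber1.
Qed.

Lemma supp1_vert x i : supp x = [set i] -> x = vert i.
Proof. by move/eqP => e; apply/set1P; rewrite -fiber1 inE. Qed.

Lemma vert_inj : injective vert.
Proof. by move=> i j /(congr1 supp); rewrite !supp_vert => /set1_inj. Qed.

(** The line [cflat T] has g + 2 points, two of which have singleton support. *)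
Lemma card_fiber2 T : #|T| = 2 -> #|fiber T| = g.
Proof.
move=> T2; have /cards2P[i [j [ne eT]]] : #|T| == 2 by rewrite T2.
have : cflat T = fiber T :|: [set vert i; vert j].
  apply/setP=> x; rewrite !inE; apply/idP/idP.
    have [->//|neT] := eqVneq (supp x) T; move=> sT /=.
    have : #|supp x| < 2.
      by rewrite -T2 proper_card // properEneq neT.
    rewrite ltnS => le1; have /cards1P[k ek] : #|supp x| == 1.
      by rewrite eqn_leq le1 card_gt0 supp_neq0.
    move: sT; rewrite (supp1_vert ek) supp_vert sub1set eT !inE.
    by case/orP=> /eqP->; rewrite eqxx ?orbT.
  by case/orP=> [/eqP->//|/orP[]/eqP->]; rewrite supp_vert sub1set eT !inE eqxx ?orbT.
move/(congr1 (fun A : {set E} => #|A|)); rewrite card_cflat T2 cardsU lsize_small.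
have -> : fiber T :&: [set vert i; vert j] = set0.
  apply/setP=> x; rewrite !inE; apply/negP=> /andP[/eqP eS /orP[]/eqP e];
  by move: T2; rewrite -eS e supp_vert cards1.
by rewrite cards2 (inj_eq vert_inj) ne cards0; nlia.
Qed.

Lemma sum_draws n m : \sum_(T : {set 'I_r} | #|T| == n) m = 'C(r, n) * m.
Proof.
have := card_draws 'I_r n; rewrite card_ord => <-; rewrite -sum_nat_const.
by apply: eq_bigl => T; rewrite inE.
Qed.

Lemma card_supp_eq n (m : nat) : (forall T, #|T| = n -> #|fiber T| = m) ->
  #|[set x | #|supp x| == n]| = 'C(r, n) * m.
Proof.
move=> fm; rewrite -sum1_card (partition_big supp (fun T => #|T| == n)); last first.
  by move=> x; rewrite inE.
rewrite -sum_draws; apply: eq_bigr => T /eqP eT; rewrite -(fm T eT) -sum1_card.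
by apply: eq_bigl => x; rewrite !inE andb_idl // => /eqP->; rewrite eT.
Qed.

(** The points with such supports already number r + g C(r,2), the size of the ground set. *)
Lemma supp_card x : #|supp x| = 1 \/ #|supp x| = 2.
Proof.
have c1 : #|[set x | #|supp x| == 1]| = r.
  rewrite (@card_supp_eq 1 1) ?bin1 ?muln1 // => T /eqP/cards1P[i ->].
  exact: card_fiber1.
have c2 := card_supp_eq card_fiber2.
have : [set x | #|supp x| == 1] :|: [set x | #|supp x| == 2] = setT.
  apply/eqP; rewrite eqEcard subsetT cardsT hcard cardsU c1 c2.
  suff -> : [set x | #|supp x| == 1] :&: [set x | #|supp x| == 2] = set0.
    by rewrite cards0; nlia.
  by apply/setP=> y; rewrite !inE; case: eqP => // ->.
by move/setP/(_ x); rewrite !inE => /orP[]/eqP; [left|right].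
Qed.

Lemma cflatU1 T i : i \notin T -> cl M (vert i |: cflat T) = cflat (i |: T).
Proof.
move=> iT; apply: cl_rk; rewrite ?flat_cflat //.
  rewrite subUset sub1set inE supp_vert sub1set setU11.
  by apply/subsetP=> x; rewrite !inE => /subset_trans-> //; rewrite subsetUr.
rewrite rkU1_flat ?flat_cflat // ?rk_cflat ?cardsU1 ?iT //.
by rewrite inE supp_vert sub1set.
Qed.

Lemma cl_verts T : cl M (vert @: T) = cflat T.
Proof.
have [n] := ubnP #|T|; elim: n T => // n IHn T ltT.
have [->|[i iT]] := set_0Vmem T.
  rewrite imset0; have -> : cflat set0 = set0.
    by apply/eqP; rewrite -cards_eq0 card_cflat cards0 lsize_small.
  exact/flatP/(flat0 sM).
rewrite -(setD1K iT) imsetU1 -cflatU1 ?setD11 // -IHn ?clU_cl //.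
by rewrite (cardsD1 i T) iT in ltT.
Qed.

Lemma cflatT : cflat setT = setT.
Proof. by apply/setP=> x; rewrite !inE subsetT. Qed.

Lemma rk_verts T : rk M (vert @: T) = #|T|.
Proof. by rewrite -rk_cl cl_verts rk_cflat. Qed.

Lemma frame_basis : exists2 B : {set E}, basis M B &
  forall X : {set E}, X \subset B -> large M g (cl M X).
Proof.
exists (vert @: setT) => [|X sX].
  apply/maxsetP; split=> [|Y /eqP iY sY].
    by rewrite /indep rk_verts card_imset //; apply: vert_inj.
  apply/eqP; rewrite eq_sym eqEcard sY -iY card_imset ?[X in _ <= X]cardsT; last exact: vert_inj.
  by rewrite -(cardsT 'I_r) -rk_cflat cflatT rk_mono ?subsetT.
have -> : X = vert @: [set i | vert i \in X].
  apply/setP=> x; apply/idP/imsetP => [xX|[i]]; last by rewrite inE => iX ->.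
  by have /imsetP[i _ e] := subsetP sX x xX; exists i; rewrite ?inE -?e.
rewrite cl_verts; have /large_rkP[fF cF rF] := cflat_large [set i | vert i \in X].
by rewrite /large fF cF rF eqxx.
Qed.

Definition suppset L := \bigcup_(x in L) supp x.

(** [x] and [y] span [L], and the [cflat] of the union of their supports is a flat containing
    both. *)
Lemma suppset_line L x y : line M L -> x \in L -> y \in L -> x != y ->
  suppset L = supp x :|: supp y.
Proof.
move=> lL xL yL ne; apply/eqP; rewrite eqEsubset subUset !(bigcup_sup _) // !andbT.
apply/bigcupsP=> z; rewrite -(cl2_line sM lL xL yL ne) => zL.
rewrite -mem_cflat; apply: subsetP zL; rewrite cl_sub ?flat_cflat //.
by rewrite subUset !sub1set !inE subsetUl subsetUr.
Qed.

Lemma line_cflat T : #|T| = 2 -> line M (cflat T).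
Proof. by move=> T2; rewrite /line flat_cflat rk_cflat T2. Qed.

Lemma line_eq_cflat L T : line M L -> suppset L \subset T -> #|T| = 2 -> L = cflat T.
Proof.
move=> /andP[fL /eqP rL] sT T2; apply: (flat_eq fL) => //; last by rewrite rk_cflat T2 rL.
by apply: sub_cflat => x xL; apply: subset_trans sT; apply: bigcup_sup.
Qed.

Definition symdiff T U := (T :\: U) :|: (U :\: T).

Lemma card_symdiff T U : #|symdiff T U| + 2 * #|T :&: U| = #|T| + #|U|.
Proof.
rewrite cardsU; have -> : (T :\: U) :&: (U :\: T) = set0.
  by apply/setP=> i; rewrite !inE; case: (i \in T); rewrite ?andbF.
have := cardsID T U; have := cardsID U T.
by rewrite cards0 [U :&: T]setIC; nlia.
Qed.

(** By [suppset_line] any two of the three supports have the same union, so an index in one of them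
    lies in at least two. The union has at least three indices, since otherwise [L] would be a
    [cflat] or a single point. With supports of size at most two, only the three sides of a triangle
    are possible. *)
Lemma line_supp L x y z : line M L -> x \in L -> y \in L -> z \in L ->
  x != y -> x != z -> y != z -> (forall T, #|T| = 2 -> L != cflat T) ->
  [/\ #|suppset L| = 3, #|supp x| = 2 & supp z = symdiff (supp x) (supp y)].
Proof.
move=> lL xL yL zL nxy nxz nyz nc.
have exy := suppset_line lL xL yL nxy.
have exz := suppset_line lL xL zL nxz.
have eyz := suppset_line lL yL zL nyz.
have U3 : 2 < #|suppset L|.
  rewrite ltnNge; apply/negP=> U2; have: #|suppset L| != 1 -> False.
    move=> U1; suff eU : #|suppset L| = 2 by case/eqP: (nc _ eU); apply: line_eq_cflat.
    have := supp_neq0 x; rewrite -card_gt0.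
    have := subset_leq_card (subsetUl (supp x) (supp y)); rewrite -exy; nlia.
  case: eqP => [/eqP/cards1P[i eU] _|_]; last exact.
  have ex w : w \in L -> w = vert i.
    move=> wL; apply: supp1_vert; apply/eqP.
    have : supp w \subset suppset L by apply: bigcup_sup.
    by rewrite eU subset1 (negPf (supp_neq0 w)) orbF.
  by move: nxy; rewrite (ex _ xL) (ex _ yL) eqxx.
have sD : symdiff (supp x) (supp y) \subset supp z.
  apply/subsetP=> i; rewrite !inE => /orP[/andP[niy ix]|/andP[nix iy]].
    have : i \in suppset L by rewrite exy inE ix.
    by rewrite eyz inE (negPf niy).
  have : i \in suppset L by rewrite exy inE iy orbT.
  by rewrite exz inE (negPf nix).
have cD := card_symdiff (supp x) (supp y).
have cU := cardsUI (supp x) (supp y); rewrite -exy in cU.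
have leD := subset_leq_card sD.
have [cx cy cz] := And3 (supp_card x) (supp_card y) (supp_card z).
split; [nlia|nlia|]; apply/esym/eqP; rewrite eqEcard sD; nlia.
Qed.

Definition adj x y := [&& #|supp x| == 2, #|supp y| == 2 & #|supp x :&: supp y| == 1].

Lemma adj_card x y : adj x y -> #|supp x :|: supp y| = 3.
Proof. by case/and3P=> /eqP cx /eqP cy /eqP cI; rewrite cardsU; nlia. Qed.

(** A fourth point would have the support of [z], and the line through both would then involve two
    indices only. *)
Lemma line3P L x y z : line M L -> x \in L -> y \in L -> z \in L ->
  x != y -> x != z -> y != z -> (forall T, #|T| = 2 -> L != cflat T) ->
  [/\ L = [set x; y; z], adj x y & supp z = symdiff (supp x) (supp y)].
Proof.
move=> lL xL yL zL nxy nxz nyz nc.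
have [U3 cx eDz] := line_supp lL xL yL zL nxy nxz nyz nc.
have [|_ cy _] := line_supp lL yL xL zL _ nyz nxz nc; first by rewrite eq_sym.
have [||_ cz _] := line_supp lL zL xL yL _ _ nxy nc; rewrite 1?eq_sym //.
have exy := suppset_line lL xL yL nxy.
split=> //; last by rewrite /adj cx cy; have := cardsUI (supp x) (supp y); rewrite -exy; nlia.
apply/setP=> w; rewrite !inE; apply/idP/idP; last first.
  by case/orP=> [/orP[]|] /eqP->.
move=> wL; apply: contraT; rewrite !negb_or -andbA => /and3P[nwx nwy nwz].
rewrite eq_sym in nwx; rewrite eq_sym in nwy; rewrite eq_sym in nwz.
have [_ _ eDw] := line_supp lL xL yL wL nxy nwx nwy nc.
by have := suppset_line lL zL wL nwz; rewrite eDw -eDz setUid => e; rewrite e cz in U3.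
Qed.

Lemma three_point_lineP L : reflect
  (exists x y z, [/\ line M L, L = [set x; y; z], [&& x != y, x != z & y != z],
      adj x y & supp z = symdiff (supp x) (supp y)])
  (L \in three_point_lines M).
Proof.
apply: (iffP idP) => [|[x [y [z [lL eL /and3P[nxy nxz nyz] _ _]]]]]; last first.
  by rewrite inE lL eL /= setUC cardsU1 cards2 !inE negb_or nxy
    [z == x]eq_sym nxz [z == y]eq_sym nyz.
rewrite inE => /andP[lL /eqP L3].
have nc T : #|T| = 2 -> L != cflat T.
  move=> T2; apply/eqP=> e; move: L3; rewrite e card_cflat T2 lsize_small; nlia.
have [x xL] : exists x, x \in L by apply/card_gt0P; rewrite L3.
have [|y yL] := @ltn_card_exists _ [set x] L; first by rewrite cards1 L3.
rewrite inE eq_sym => nxy.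
have [|z zL] := @ltn_card_exists _ [set x; y] L; first by rewrite cards2 nxy L3.
rewrite !inE negb_or ![z == _]eq_sym => /andP[nxz nyz].
have [eL axy eD] := line3P lL xL yL zL nxy nxz nyz nc.
by exists x, y, z; split=> //; rewrite nxy nxz.
Qed.

Definition lines_on T := [set L in three_point_lines M | suppset L == T].

(** A three-point line over the triangle [T] has one point over each side, so its points over [P]
    and [Q] span it. *)
Lemma lines_on_sub T P Q : #|T| = 3 -> P \subset T -> Q \subset T ->
  #|P| = 2 -> #|Q| = 2 -> P != Q ->
  lines_on T \subset (fun p => cl M [set p.1; p.2]) @: setX (fiber P) (fiber Q).
Proof.
move=> T3 sPT sQT P2 Q2 nPQ; apply/subsetP=> L; rewrite inE.
case/andP=> /three_point_lineP[x [y [z [lL eL /and3P[nxy nxz nyz] axy eD]]]] /eqP eT.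
have [cx cy cI] := and3P axy.
have cz : #|supp z| = 2.
  by have := card_symdiff (supp x) (supp y); rewrite -eD; nlia.
have xL : x \in L by rewrite eL !inE eqxx.
have yL : y \in L by rewrite eL !inE eqxx orbT.
have zL : z \in L by rewrite eL !inE eqxx !orbT.
have sup w : w \in L -> supp w \subset T by rewrite -eT; apply: bigcup_sup.
have ne u v : u \in L -> v \in L -> u != v -> #|supp v| = 2 -> supp u != supp v.
  move=> uL vL /(suppset_line lL uL vL) e cv; apply/eqP=> e'.
  by move: T3; rewrite -eT e e' setUid cv.
have e3 : [set supp x; supp y; supp z] = [set A : {set 'I_r} | A \subset T & #|A| == 2].
  apply/eqP; rewrite eqEcard; apply/andP; split.
    by apply/subsetP=> A; rewrite !inE => /orP[/orP[]|]/eqP->; rewrite sup // ?cx ?cy ?cz.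
  rewrite cards_draws T3 setUC cardsU1 cards2 !inE negb_or.
  by rewrite ![supp z == _]eq_sym !ne ?(eqP cy).
have pick P' : P' \subset T -> #|P'| = 2 -> exists2 w, w \in L & supp w = P'.
  move=> sP' cP'; have : P' \in [set supp x; supp y; supp z].
    by rewrite e3 inE sP' cP'.
  by rewrite !inE => /orP[/orP[]|]/eqP->; [exists x|exists y|exists z].
have [u uL eu] := pick P sPT P2; have [v vL ev] := pick Q sQT Q2.
apply/imsetP; exists (u, v); first by rewrite !inE eu ev !eqxx.
rewrite (cl2_line sM lL) //=; apply: contraNneq nPQ => e.
by rewrite -eu -ev e.
Qed.

Lemma card_lines_on_le T P Q : #|T| = 3 -> P \subset T -> Q \subset T ->
  #|P| = 2 -> #|Q| = 2 -> P != Q -> #|lines_on T| <= g ^ 2.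
Proof.
move=> T3 sPT sQT P2 Q2 nPQ.
have := subset_leq_card (lines_on_sub T3 sPT sQT P2 Q2 nPQ) => /leq_trans; apply.
by apply: leq_trans (leq_imset_card _ _) _; rewrite cardsX !card_fiber2.
Qed.

Lemma two_pairs T : #|T| = 3 -> exists P Q : {set 'I_r},
  [/\ P \subset T, Q \subset T, #|P| = 2, #|Q| = 2 & P != Q].
Proof.
move=> T3; have : 1 < #|[set A : {set 'I_r} | A \subset T & #|A| == 2]|.
  by rewrite cards_draws T3.
case/card_gt1P=> P [Q []]; rewrite !inE => /andP[sP /eqP cP] /andP[sQ /eqP cQ] ne.
by exists P, Q.
Qed.

Lemma card_lines_on T : #|T| = 3 -> #|lines_on T| <= g ^ 2.
Proof.
move=> T3; have [P [Q [sP sQ cP cQ ne]]] := two_pairs T3.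
exact: card_lines_on_le T3 sP sQ cP cQ ne.
Qed.

Lemma card_three_point_lines_sum :
  #|three_point_lines M| = \sum_(T : {set 'I_r} | #|T| == 3) #|lines_on T|.
Proof.
rewrite -sum1_card (partition_big suppset (fun T => #|T| == 3)).
  by apply: eq_bigr => T _; rewrite -sum1_card; apply: eq_bigl => L; rewrite !inE.
move=> L /three_point_lineP[x [y [z [lL eL /and3P[nxy _ _] axy _]]]].
rewrite (suppset_line lL _ _ nxy) ?(adj_card axy) // eL !inE eqxx ?orbT //.
Qed.

Lemma card_three_point_lines : #|three_point_lines M| <= 'C(r, 3) * g ^ 2.
Proof.
rewrite card_three_point_lines_sum -sum_draws; apply: leq_sum => T /eqP.
exact: card_lines_on.
Qed.

Definition on i j x := supp x == [set i; j].

Lemma onC i j x : on i j x = on j i x.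
Proof. by rewrite /on setUC. Qed.

Lemma on_adj i j k x y : i != j -> j != k -> i != k ->
  on i j x -> on j k y -> adj x y.
Proof.
move=> nij njk nik /eqP ex /eqP ey; rewrite /adj ex ey !cards2 nij njk /=.
apply/cards1P; exists j; apply/setP=> l; rewrite !inE.
have [->|nlj] := eqVneq l j; first by rewrite orbT.
by rewrite orbF /=; apply/andP=> -[/eqP-> /eqP e]; rewrite e eqxx in nik.
Qed.

Lemma set2_lt_inj (i j k l : 'I_r) : i < j -> k < l ->
  [set i; j] = [set k; l] -> i = k /\ j = l.
Proof.
move=> lij lkl eS; have := set21 i j; have := set22 i j.
rewrite {1 2}eS !inE => /orP[]/eqP ej /orP[]/eqP ei //; subst.
- by rewrite ltnn in lij.
- by have := ltn_trans lij lkl; rewrite ltnn.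
by rewrite ltnn in lij.
Qed.

(** * Labelling the ground set by Dowling points *)

Section Labelling.
Variables (G : finType) (cG : #|G| = g) (nu : 'I_r -> 'I_r -> G -> E).
Hypothesis nu_on : forall (i j : 'I_r) a, i < j -> on i j (nu i j a).
Hypothesis nu_inj : forall i j : 'I_r, i < j -> injective (nu i j).

Definition label (p : dowling_pt r G) : E :=
  match p with
  | inl i => vert i
  | inr (a, ij) => nu (val ij).1 (val ij).2 a
  end.

Lemma supp_label p : supp (label p) =
  match p with inl i => [set i] | inr (_, ij) => [set (val ij).1; (val ij).2] end.
Proof.
by case: p => [i|[a [[i j] lt]]]; [apply: supp_vert|apply/eqP/nu_on].
Qed.

Lemma label_inj : injective label.
Proof.
move=> p q e; have := congr1 supp e; rewrite !supp_label.
case: p q e => [i|[a [[i j] lt]]] [k|[b [[k l] lt']]] /= e.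
- by move/set1_inj->.
- by move/(congr1 (fun A : {set 'I_r} => #|A|)); rewrite cards1 cards2 neq_ltn lt'.
- by move/(congr1 (fun A : {set 'I_r} => #|A|)); rewrite cards1 cards2 neq_ltn lt.
move=> /(@set2_lt_inj i j k l lt lt')[eik ejl]; subst k l.
rewrite (bool_irrelevance lt' lt) in e *.
by rewrite (nu_inj lt e).
Qed.

Lemma nu_surj (i j : 'I_r) x : i < j -> on i j x -> exists a, x = nu i j a.
Proof.
move=> lt xon; have ne : i != j by rewrite neq_ltn lt.
have /eqP/setP/(_ x) : [set nu i j a | a in G] == fiber [set i; j].
  rewrite eqEcard card_imset ?card_fiber2 ?cards2 ?ne // ?cG ?leqnn ?andbT; last exact: nu_inj.
  by apply/subsetP=> _ /imsetP[a _ ->]; rewrite inE; apply: nu_on.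
by rewrite [in RHS]inE; move: xon; rewrite /on => -> /imsetP[a _ ->]; exists a.
Qed.

Lemma label_bij : bijective label.
Proof.
apply: inj_card_bij label_inj _.
rewrite -cardsT -[X in _ <= X](card_codom label_inj).
apply: subset_leq_card; apply/subsetP=> x _; apply/codomP.
have [/eqP/cards1P[i ex]|/eqP/cards2P[i [j [ne ex]]]] := supp_card x.
  by exists (inl i); apply: supp1_vert.
wlog lt : i j ne ex / i < j => [hwlog|].
  have := ne; rewrite neq_ltn => /orP[]; first exact: hwlog.
  by apply: hwlog; rewrite 1?eq_sym // ex setUC.
have [|a ->] := @nu_surj i j x lt; first by rewrite /on ex.
by exists (pt_a a lt).
Qed.

Lemma label_large_flat T : label @: large_flat G T = cflat T.
Proof.
have memE p : (p \in large_flat G T) = (supp (label p) \subset T).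
  rewrite supp_label inE; case: p => [i|[a ij]]; first by rewrite sub1set.
  by rewrite subUset !sub1set.
apply/setP=> x; have [h _ hK] := label_bij; rewrite -(hK x).
by rewrite (mem_imset _ _ label_inj) memE mem_cflat.
Qed.

Lemma label_pt_a i j (lt : i < j) a : label (pt_a a lt) = nu i j a.
Proof. by []. Qed.

End Labelling.

(** Arbitrary enumerations suffice in rank three: changing them replaces the quasigroup by an
    isotopic one. *)
Lemma fiber_labelling : exists nu : 'I_r -> 'I_r -> 'I_g -> E,
  (forall (i j : 'I_r) a, i < j -> on i j (nu i j a)) /\
  (forall i j : 'I_r, i < j -> injective (nu i j)).
Proof.
pose nu i j (a : 'I_g) := nth (vert i) (enum (fiber [set i; j])) a.
have sz (i j : 'I_r) : i < j -> size (enum (fiber [set i; j])) = g.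
  by move=> lt; rewrite -cardE card_fiber2 // cards2 neq_ltn lt.
exists nu; split=> [i j a lt|i j lt a b /eqP].
  have : nu i j a \in enum (fiber [set i; j]) by rewrite mem_nth // sz.
  by rewrite mem_enum inE.
by rewrite nth_uniq ?enum_uniq ?sz // => /eqP/val_inj.
Qed.

Lemma line_ge3 L T P Q : line M L -> 3 <= #|L| -> suppset L \subset T -> #|T| = 3 ->
  P \subset T -> Q \subset T -> #|P| = 2 -> #|Q| = 2 -> P != Q ->
  (exists2 U : {set 'I_r}, #|U| = 2 & L = cflat U) \/
  (exists x y, [/\ supp x = P, supp y = Q & L = cl M [set x; y]]).
Proof.
move=> lL L3 sLT T3 sP sQ P2 Q2 nPQ.
have [/existsP[U /andP[/eqP U2 /eqP eU]]|nU] :=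
    boolP [exists U : {set 'I_r}, (#|U| == 2) && (L == cflat U)].
  by left; exists U.
right; have nc (U : {set 'I_r}) : #|U| = 2 -> L != cflat U.
  by move=> U2; apply: contra nU => eU; apply/existsP; exists U; rewrite U2 eU.
have [x xL] : exists x, x \in L by apply/card_gt0P; nlia.
have [|y yL] := @ltn_card_exists _ [set x] L; first by rewrite cards1 ltnW.
rewrite inE eq_sym => nxy.
have [|z zL] := @ltn_card_exists _ [set x; y] L; first by rewrite cards2 nxy.
rewrite !inE negb_or ![z == _]eq_sym => /andP[nxz nyz].
have [U3 _ _] := line_supp lL xL yL zL nxy nxz nyz nc.
have eT : suppset L = T by apply/eqP; rewrite eqEcard sLT T3 U3.
have [eL axy eD] := line3P lL xL yL zL nxy nxz nyz nc.
have : L \in lines_on T.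
  rewrite inE eT eqxx andbT; apply/three_point_lineP.
  by exists x, y, z; split=> //; rewrite nxy nxz.
move/(subsetP (lines_on_sub T3 sP sQ P2 Q2 nPQ)) => /imsetP[[u v]].
by rewrite !inE /= => /andP[/eqP eu /eqP ev] ->; exists u, v.
Qed.

(** * The third-point product in the extremal case *)

Section Extremal.
Hypothesis extremal : #|three_point_lines M| = 'C(r, 3) * g ^ 2.

(** The total equals the sum of the upper bounds of its terms, so every term attains its bound. *)
Lemma card_lines_on_eq T : #|T| = 3 -> #|lines_on T| = g ^ 2.
Proof.
move=> T3; apply/eqP; rewrite eqn_leq card_lines_on //=.
have := extremal; rewrite card_three_point_lines_sum -sum_draws.
rewrite (bigD1 T) ?T3 //= [in RHS](bigD1 T) ?T3 //=.
rewrite -(leq_add2r (\sum_(U : {set 'I_r} | (#|U| == 3) && (U != T)) g ^ 2)).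
move=> <-; rewrite leq_add2l.
by apply: leq_sum => U /andP[/eqP U3 _]; apply: card_lines_on.
Qed.

(** The g^2 lines over a triangle are among the lines spanned by the g^2 pairs over two of its
    sides, so every pair spans one. *)
Lemma adj_line x y : adj x y -> cl M [set x; y] \in three_point_lines M.
Proof.
move=> axy; have [/eqP cx /eqP cy /eqP cI] := and3P axy.
have T3 := adj_card axy.
have ne : supp x != supp y by apply: contra_eqN cI => /eqP->; rewrite setIid cy.
have sL := lines_on_sub T3 (subsetUl _ _) (subsetUr _ _) cx cy ne.
have /eqP/setP/(_ (cl M [set x; y])) :
    lines_on (supp x :|: supp y) ==
    (fun p => cl M [set p.1; p.2]) @: setX (fiber (supp x)) (fiber (supp y)).
  rewrite eqEcard sL card_lines_on_eq //.
  by apply: leq_trans (leq_imset_card _ _) _; rewrite cardsX !card_fiber2.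
move=> e; suff : cl M [set x; y] \in lines_on (supp x :|: supp y).
  by rewrite inE => /andP[].
by rewrite e; apply/imsetP; exists (x, y); rewrite ?inE /= ?eqxx.
Qed.

Definition tp x y : E := odflt x [pick z | [&& z \in cl M [set x; y], z != x & z != y]].

Lemma adj_neq x y : adj x y -> x != y.
Proof.
case/and3P=> _ cy /eqP cI; apply: contra_eqN cI => /eqP->.
by rewrite setIid (eqP cy).
Qed.

Lemma tpP x y : adj x y ->
  [/\ cl M [set x; y] = [set x; y; tp x y], tp x y != x, tp x y != y,
      adj x (tp x y) & supp (tp x y) = symdiff (supp x) (supp y)].
Proof.
move=> axy; have nxy := adj_neq axy.
have := adj_line axy; rewrite inE => /andP[lL /eqP L3].
have nc T : #|T| = 2 -> cl M [set x; y] != cflat T.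
  by move=> T2; apply/eqP=> e; move: L3; rewrite e card_cflat T2 lsize_small; nlia.
have [xL yL] : x \in cl M [set x; y] /\ y \in cl M [set x; y].
  by have /subsetP sL := sub_cl M [set x; y]; rewrite !sL ?set21 ?set22.
rewrite /tp; case: pickP => [z /and3P[zL nzx nzy]|nz] /=.
  have nxz : x != z by rewrite eq_sym.
  have nyz : y != z by rewrite eq_sym.
  have [eL _ eD] := line3P lL xL yL zL nxy nxz nyz nc.
  by have [_ axz _] := line3P lL xL zL yL nxz nxy nzy nc.
have [|z zL] := @ltn_card_exists _ [set x; y] (cl M [set x; y]).
  by rewrite L3 cards2 nxy.
by rewrite !inE negb_or => /andP[nzx nzy]; have := nz z; rewrite zL nzx nzy.
Qed.

Lemma mem_tp x y : adj x y -> tp x y \in cl M [set x; y].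
Proof. by move=> /tpP[-> _ _ _ _]; rewrite !inE eqxx orbT. Qed.

Lemma tp_uniq x y z : adj x y -> z \in cl M [set x; y] -> z != x -> z != y ->
  z = tp x y.
Proof.
by move=> /tpP[-> _ _ _ _]; rewrite !inE => + /negPf nx /negPf ny; rewrite nx ny => /eqP.
Qed.

Lemma adjC x y : adj x y = adj y x.
Proof. by rewrite /adj setIC andbCA. Qed.

Lemma tpC x y : adj x y -> tp x y = tp y x.
Proof.
move=> axy; have [_ nx ny _ _] := tpP axy; apply: tp_uniq; rewrite 1?adjC //.
by rewrite setUC mem_tp.
Qed.

Lemma tpK x y : adj x y -> tp x (tp x y) = y.
Proof.
move=> axy; have [eL nx ny axt _] := tpP axy; apply/esym/tp_uniq => //.
- have lL := line_cl2 sM (adj_neq axy).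
  have /subsetP sL := sub_cl M [set x; y].
  rewrite (cl2_line sM lL) ?mem_tp ?sL ?set21 ?set22 //.
  by rewrite eq_sym.
- by rewrite eq_sym adj_neq.
by rewrite eq_sym.
Qed.

Lemma tpKr x y : adj x y -> tp (tp x y) y = x.
Proof.
move=> axy; have ayx : adj y x by rewrite adjC.
have [_ _ _ ayt _] := tpP ayx.
by rewrite (tpC axy) tpC 1?adjC // tpK.
Qed.

Lemma col_tp x y : adj x y -> col M x y (tp x y).
Proof.
move=> axy; apply: (col_rk (flat_cl M [set x; y])).
- by rewrite rk_cl (rk2 sM (adj_neq axy)).
- by apply: (subsetP (sub_cl _ _)); rewrite set21.
- by apply: (subsetP (sub_cl _ _)); rewrite set22.
exact: mem_tp.
Qed.

Lemma on_tp i j k x y : i != j -> j != k -> i != k ->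
  on i j x -> on j k y -> on i k (tp x y).
Proof.
move=> nij njk nik xon yon.
have [_ _ _ _ eD] := tpP (on_adj nij njk nik xon yon).
rewrite /on eD (eqP xon) (eqP yon); apply/eqP/setP=> l; rewrite !inE.
have [->|nli] := eqVneq l i; first by rewrite (negPf nij) (negPf nik).
have [->|nlj] := eqVneq l j; first by rewrite (negPf njk).
by case: (l == k).
Qed.

Lemma cflat_sub (X : {set E}) T x y : flat M X -> x \in X -> y \in X -> x != y ->
  supp x \subset T -> supp y \subset T -> #|T| = 2 -> cflat T \subset X.
Proof.
move=> fX xX yX nxy sx sy T2.
rewrite -(cl2_line sM (line_cflat T2) _ _ nxy) ?inE // cl_sub //.
by rewrite subUset !sub1set xX.
Qed.

(** Otherwise the closure of [x], [y], [z] has two points over {i,l}, hence contains [vert i] and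
    [vert l]; along [x] and [y] it also gains [vert j] and [vert k]. Four independent points do not
    fit into rank three. *)
Lemma tpA i j k l x y z :
  [/\ i != j, i != k & i != l] -> [/\ j != k, j != l & k != l] ->
  on i j x -> on j k y -> on k l z -> tp (tp x y) z = tp x (tp y z).
Proof.
move=> [nij nik nil] [njk njl nkl] xon yon zon.
have axy := on_adj nij njk nik xon yon.
have ayz := on_adj njk nkl njl yon zon.
have xyon := on_tp nij njk nik xon yon.
have yzon := on_tp njk nkl njl yon zon.
have axyz := on_adj nik nkl nil xyon zon.
have axyz' := on_adj nij njl nil xon yzon.
have uon := on_tp nik nkl nil xyon zon.
have von := on_tp nij njl nil xon yzon.
apply/eqP; apply: contraT => nuv.
have fX := flat_cl M [set x; y; z]; set X := cl M _ in fX.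
have sX := subsetP (sub_cl M [set x; y; z]).
have [xX yX zX] : [/\ x \in X, y \in X & z \in X].
  by split; apply: sX; rewrite !inE eqxx ?orbT.
have tpX u v : adj u v -> u \in X -> v \in X -> tp u v \in X.
  by move=> auv; apply: (flat_col sM fX (col_tp auv) (adj_neq auv)).
have two a b : a != b -> #|[set a; b]| = 2 by rewrite cards2 => ->.
have vX a b u v : a != b -> on a b u -> supp v \subset [set a; b] -> v != u ->
    u \in X -> v \in X -> (vert a \in X) && (vert b \in X).
  move=> nab /eqP eu sv nvu uX vX.
  have su : supp u \subset [set a; b] by rewrite eu.
  have /subsetP sub := cflat_sub fX vX uX nvu sv su (two _ _ _ nab).
  by rewrite !sub // inE supp_vert sub1set !inE eqxx ?orbT.
have nv a b c u : a != b -> on a b u -> vert c != u.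
  move=> nab /eqP eu; apply/eqP=> e; move: (two _ _ _ nab).
  by rewrite -eu -e supp_vert cards1.
have /andP[iX lX] : (vert i \in X) && (vert l \in X).
  by apply: (vX i l _ _ nil von _ nuv); rewrite ?tpX // ?tpX // (eqP uon).
have step a b u : a != b -> on a b u -> u \in X -> vert a \in X -> vert b \in X.
  move=> nab uon' uX aX; suff /andP[] : (vert a \in X) && (vert b \in X) by [].
  by apply: (vX a b u (vert a)) => //; rewrite ?supp_vert ?sub1set ?set21 // (nv a b).
have jX := step _ _ _ nij xon xX iX.
have kX := step _ _ _ njk yon yX jX.
have : vert @: [set i; j; k; l] \subset X.
  apply/subsetP=> _ /imsetP[a aI ->]; move: aI.
  by rewrite !in_setU !in_set1 -!orbA => /or4P[]/eqP->.
move/(rk_mono M); rewrite rk_verts rk_cl.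
have -> : #|[set i; j; k; l]| = 4.
  by rewrite setUC cardsU1 card3 // !inE !negb_or ![l == _]eq_sym nil njl nkl.
have := rkU_le M [set x; y] [set z]; have := rk_le_card M [set x; y].
have := rk_le_card M [set z]; rewrite cards1 cards2; case: (x != y) => /=; nlia.
Qed.

(** * The group when r >= 4 *)

Section GainGroup.
Variables o0 o1 o2 o3 : 'I_r.
Hypotheses (n01 : o0 != o1) (n02 : o0 != o2) (n03 : o0 != o3).
Hypotheses (n12 : o1 != o2) (n13 : o1 != o3) (n23 : o2 != o3).
Local Open Scope group_scope.

Lemma on_ex i j : i != j -> exists x, on i j x.
Proof.
move=> ne; have /card_gt0P[x] : 0 < #|fiber [set i; j]|.
  by rewrite card_fiber2 ?cards2 ?ne //; nlia.
by rewrite inE; exists x.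
Qed.

(** An arbitrary choice of identity elements on the sides at [o1], along which the sides at [o0] are
    identified. *)
Definition star i : E := odflt (vert i) [pick x | on o1 i x].

Lemma starP i : o1 != i -> on o1 i (star i).
Proof.
move=> ne; rewrite /star; case: pickP => // nx.
by have [x xon] := on_ex ne; have := nx x; rewrite xon.
Qed.

(* The bijection between the classes of {o0, o1} and {o0, i}, and its inverse. *)
Definition gauge i x : E := if i == o1 then x else tp x (star i).

Lemma gauge_on i x : o0 != i -> on o0 o1 x -> on o0 i (gauge i x).
Proof.
rewrite /gauge => n0i; case: eqVneq => [-> //|ne xon].
by apply: on_tp xon (starP _); rewrite // eq_sym.
Qed.

Lemma gauge_on1 i x : o0 != i -> on o0 i x -> on o0 o1 (gauge i x).
Proof.
rewrite /gauge => n0i; case: eqVneq => [-> //|ne xon].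
by apply: on_tp xon _ => //; rewrite onC starP // eq_sym.
Qed.

Lemma gaugeK i x : o0 != i -> on o0 o1 x -> gauge i (gauge i x) = x.
Proof.
rewrite /gauge => n0i; case: eqVneq => [// |ne xon]; apply: tpKr.
by apply: on_adj xon (starP _); rewrite // eq_sym.
Qed.

Lemma gauge1K i x : o0 != i -> on o0 i x -> gauge i (gauge i x) = x.
Proof.
rewrite /gauge => n0i; case: eqVneq => [// |ne xon]; apply: tpKr.
by apply: (on_adj _ _ _ xon (_ : on i o1 _)) => //; rewrite onC starP // eq_sym.
Qed.

(* A bridge plays the role of the identity element of the class of {i, j}. *)
Definition bridges i j w := on i j w /\
  forall x, on o0 o1 x -> tp (gauge i x) w = gauge j x.

(** The bridge is the detour through [o1], the third point of [star i] and [star j]; [tpA] on the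
    path o0, o1, i, j verifies it. *)
Lemma bridge i j : o0 != i -> o0 != j -> i != j -> exists w, bridges i j w.
Proof.
move=> n0i n0j nij; have [ei|ni] := eqVneq i o1.
  subst i; exists (star j); split=> [|x xon]; first exact: starP.
  by rewrite /gauge eqxx eq_sym (negPf nij).
have [ej|nj] := eqVneq j o1.
  subst j; exists (star i); split=> [|x xon]; first by rewrite onC starP // eq_sym.
  rewrite /gauge eqxx (negPf ni); apply: tpKr.
  by apply: on_adj xon (starP _); rewrite // eq_sym.
have n1i : o1 != i by rewrite eq_sym.
have n1j : o1 != j by rewrite eq_sym.
have si := starP n1i; have sj := starP n1j.
have si' : on i o1 (star i) by rewrite onC.
exists (tp (star i) (star j)); split=> [|x xon].
  exact: (on_tp ni n1j nij si' sj).
have aij := on_adj ni n1j nij si' sj.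
have wij := on_tp ni n1j nij si' sj.
rewrite /gauge (negPf ni) (negPf nj) (@tpA o0 o1 i j) //.
by rewrite tpK.
Qed.

(* Carry x from {o0,o1} to {o0,i}, multiply by y to reach {o0,j}, and carry the *)
(* result back. *)
Definition gain_fun i j y x : E :=
  if on o0 o1 x then gauge j (tp (gauge i x) y) else x.

Lemma gain_fun_on i j y x : o0 != i -> o0 != j -> i != j -> on i j y ->
  on o0 o1 x -> on o0 o1 (gain_fun i j y x).
Proof.
move=> n0i n0j nij yon xon; rewrite /gain_fun xon; apply: gauge_on1 => //.
exact: on_tp (gauge_on n0i xon) yon.
Qed.

Lemma gain_funK i j y : o0 != i -> o0 != j -> i != j -> on i j y ->
  cancel (gain_fun i j y) (gain_fun j i y).
Proof.
move=> n0i n0j nij yon x; have [xon|xn] := boolP (on o0 o1 x); last first.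
  by rewrite /gain_fun (negPf xn) (negPf xn).
have zon := gain_fun_on n0i n0j nij yon xon.
rewrite {1}/gain_fun zon /gain_fun xon.
have ton := on_tp n0i nij n0j (gauge_on n0i xon) yon.
rewrite gauge1K // tpKr ?gaugeK //.
exact: on_adj (gauge_on n0i xon) yon.
Qed.

(* Opaque, because unfolding [gain] makes unification intractable. *)
Lemma gain_spec i j y : {s : {perm E} |
  [&& o0 != i, o0 != j, i != j & on i j y] -> s =1 gain_fun i j y}.
Proof.
have [/and4P[n0i n0j nij yon]|_] := boolP [&& _, _, _ & _]; last by exists 1.
by exists (perm (can_inj (gain_funK n0i n0j nij yon))) => _ x; rewrite permE.
Qed.

Definition gain i j y := sval (gain_spec i j y).

Lemma gainE i j y x : o0 != i -> o0 != j -> i != j -> on i j y ->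
  gain i j y x = gain_fun i j y x.
Proof.
move=> n0i n0j nij yon; apply: (svalP (gain_spec i j y)).
by rewrite n0i n0j nij.
Qed.

Lemma gain_mul i j k y z : [/\ o0 != i, o0 != j & o0 != k] ->
  [/\ i != j, j != k & i != k] -> on i j y -> on j k z ->
  gain i j y * gain j k z = gain i k (tp y z).
Proof.
move=> [n0i n0j n0k] [nij njk nik] yon zon; apply/permP=> x.
have ton := on_tp nij njk nik yon zon.
rewrite (permM (gain i j y) (gain j k z) x) (gainE x n0i n0j nij yon).
rewrite (gainE (gain_fun i j y x) n0j n0k njk zon).
rewrite (gainE x n0i n0k nik ton).
have [xon|xn] := boolP (on o0 o1 x); last first.
  by rewrite /gain_fun (negPf xn) (negPf xn).
have zon' := gain_fun_on n0i n0j nij yon xon.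
have gon := gauge_on n0i xon.
have ton' := on_tp n0i nij n0j gon yon.
rewrite {1}/gain_fun zon' /gain_fun xon gauge1K //.
by rewrite (@tpA o0 i j k).
Qed.

Lemma gain_bridge i j w : o0 != i -> o0 != j -> i != j -> bridges i j w ->
  gain i j w = 1.
Proof.
move=> n0i n0j nij [won hw]; apply/permP=> x; rewrite gainE // perm1 /gain_fun.
by case: ifP => // xon; rewrite hw ?gaugeK.
Qed.

Definition gains i j := [set gain i j y | y in fiber [set i; j]].

Lemma mem_gains i j y : on i j y -> gain i j y \in gains i j.
Proof. by move=> yon; apply: imset_f; rewrite inE. Qed.

Lemma gainsP i j s : s \in gains i j -> exists2 y, on i j y & s = gain i j y.
Proof. by case/imsetP=> y; rewrite inE; exists y. Qed.

(** A bridge has gain 1, so multiplying by it changes an end index but not the permutation. *)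
Lemma sub_gainsr i j k : [/\ o0 != i, o0 != j & o0 != k] ->
  [/\ i != j, j != k & i != k] -> gains i j \subset gains i k.
Proof.
move=> n0 n; have [n0i n0j n0k] := n0; have [nij njk nik] := n.
apply/subsetP=> _ /gainsP[y yon ->].
have [w bw] := bridge n0j n0k njk.
rewrite -[gain i j y]mulg1 -(gain_bridge n0j n0k njk bw).
by rewrite (gain_mul n0 n yon bw.1) mem_gains // (on_tp nij njk nik yon bw.1).
Qed.

Lemma sub_gainsl i j k : [/\ o0 != i, o0 != j & o0 != k] ->
  [/\ i != j, j != k & i != k] -> gains i j \subset gains k j.
Proof.
move=> [n0i n0j n0k] [nij njk nik]; apply/subsetP=> _ /gainsP[y yon ->].
have nki : k != i by rewrite eq_sym.
have nkj : k != j by rewrite eq_sym.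
have [w bw] := bridge n0k n0i nki.
rewrite -[gain i j y]mul1g -(gain_bridge n0k n0i nki bw).
rewrite (gain_mul (And3 n0k n0i n0j) (And3 nki nij nkj) bw.1 yon).
by rewrite mem_gains // (on_tp nki nij nkj bw.1 yon).
Qed.

Lemma gainsr i j k : [/\ o0 != i, o0 != j & o0 != k] ->
  [/\ i != j, j != k & i != k] -> gains i j = gains i k.
Proof.
move=> [n0i n0j n0k] [nij njk nik]; apply/eqP; rewrite eqEsubset.
by rewrite !sub_gainsr //; split=> //; rewrite eq_sym.
Qed.

Lemma gainsl i j k : [/\ o0 != i, o0 != j & o0 != k] ->
  [/\ i != j, j != k & i != k] -> gains i j = gains k j.
Proof.
move=> [n0i n0j n0k] [nij njk nik]; apply/eqP; rewrite eqEsubset.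
by rewrite !sub_gainsl //; split=> //; rewrite eq_sym.
Qed.

Definition gain_set := gains o1 o2.

(** The first index is moved to [o1], whence [j != o1], and then the second to [o2]. *)
Lemma gains_gain_set i j : [/\ o0 != i, o0 != j & i != j] -> j != o1 ->
  gains i j = gain_set.
Proof.
move=> [n0i n0j nij] nj; have n1j : o1 != j by rewrite eq_sym.
have -> : gains i j = gains o1 j.
  by have [->//|ni] := eqVneq i o1; apply: gainsl; split=> //; rewrite eq_sym.
by have [->//|nj2] := eqVneq j o2; apply: gainsr; split=> //; rewrite eq_sym.
Qed.

(** The second factor can be read over {o2,o3}, so that the product is a gain over {o1,o3}; this
    takes a fourth index. *)
Lemma gain_group_set : group_set gain_set.
Proof.
apply/group_setP; split=> [|s t].
  have [w bw] := bridge n01 n02 n12.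
  by rewrite -(gain_bridge n01 n02 n12 bw) mem_gains // bw.1.
have e23 : gains o2 o3 = gain_set by apply: gains_gain_set; rewrite // eq_sym.
have e13 : gains o1 o3 = gain_set by apply: gains_gain_set; rewrite // eq_sym.
move=> /gainsP[y yon ->]; rewrite -{1}e23 => /gainsP[z zon ->].
by rewrite gain_mul // -e13 mem_gains // (on_tp n12 n23 n13 yon zon).
Qed.

Canonical gain_group := Group gain_group_set.

Lemma base_ex : exists x, on o0 o1 x. Proof. exact: on_ex. Qed.

Definition base := xchoose base_ex.

Lemma base_on : on o0 o1 base. Proof. exact: xchooseP base_ex. Qed.

(** The image of one base point recovers [y], so the gains act freely on the class of {o0,o1}. *)
Lemma gain_base i j y : o0 != i -> o0 != j -> i != j -> on i j y ->
  y = tp (gauge i base) (gauge j (gain i j y base)).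
Proof.
move=> n0i n0j nij yon; rewrite gainE // /gain_fun base_on.
have gon := gauge_on n0i base_on; have ton := on_tp n0i nij n0j gon yon.
by rewrite gauge1K // tpK //; apply: on_adj gon yon.
Qed.

Lemma gain_set_inj s t : s \in gain_set -> t \in gain_set -> s base = t base -> s = t.
Proof.
move=> /gainsP[y yon ->] /gainsP[z zon ->] e; congr gain.
by rewrite (gain_base n01 n02 n12 yon) (gain_base n01 n02 n12 zon) e.
Qed.

Lemma card_gain_group : #|gain_group| = g.
Proof.
rewrite card_in_imset ?card_fiber2 ?cards2 ?n12 // => y z; rewrite !inE => yon zon e.
by rewrite (gain_base n01 n02 n12 yon) (gain_base n01 n02 n12 zon) e.
Qed.

Lemma gain_set_on s : s \in gain_set -> on o0 o1 (s base).
Proof. by move=> /gainsP[y yon ->]; rewrite gainE // gain_fun_on ?base_on. Qed.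

(** The point over {i,j} with gain [s]. On a side at [o0], where no gain is defined, it is the point
    to which [s] carries the base point. *)
Definition gain_label i j (s : {perm E}) : E :=
  if i == o0 then gauge j (s base) else tp (gauge i base) (gauge j (s base)).

Lemma gain_label_on i j s : o0 != j -> i != j -> s \in gain_set ->
  on i j (gain_label i j s).
Proof.
move=> n0j nij /gain_set_on son; rewrite /gain_label.
case: eqVneq => [->|ni]; first exact: gauge_on.
have n0i : o0 != i by rewrite eq_sym.
by apply: on_tp (gauge_on n0j son); rewrite // onC gauge_on ?base_on.
Qed.

Lemma gain_labelK i j s : [/\ o0 != i, o0 != j & i != j] -> j != o1 ->
  s \in gain_set -> gain i j (gain_label i j s) = s.
Proof.
move=> [n0i n0j nij] nj sH; have lon := gain_label_on n0j nij sH.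
apply: gain_set_inj => //.
  by rewrite -(@gains_gain_set i j) // mem_gains.
have son := gain_set_on sH; have ni : i != o0 by rewrite eq_sym.
rewrite gainE // /gain_fun base_on /gain_label (negPf ni).
have bon : on i o0 (gauge i base) by rewrite onC gauge_on ?base_on.
by rewrite tpK ?gaugeK //; apply: on_adj bon (gauge_on n0j son).
Qed.

Lemma gain_label_inj i j : o0 != j -> i != j -> j != o1 \/ i = o0 ->
  {in gain_set &, injective (gain_label i j)}.
Proof.
move=> n0j nij nj s t sH tH e.
have [i0|ni] := eqVneq i o0.
  apply: gain_set_inj => //; move: e; rewrite /gain_label i0 eqxx.
  by move/(congr1 (gauge j)); rewrite !gaugeK ?gain_set_on.
case: nj => [nj|ei]; last by rewrite ei eqxx in ni.
have n0i : o0 != i by rewrite eq_sym.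
by rewrite -(@gain_labelK i j s) // -(@gain_labelK i j t) // e.
Qed.

(** For [i != o0] both sides have the same gain. For [i = o0] this is the action of [t] on [s base],
    products of permutations applying the left factor first. The conditions on [o1] hold for i < j <
    k when [o0] and [o1] are the two least indices. *)
Lemma gain_label_mul i j k s t : [/\ i != j, j != k & i != k] ->
  [/\ o0 != j, o0 != k, k != o1 & i != o0 -> j != o1] ->
  s \in gain_set -> t \in gain_set ->
  tp (gain_label i j s) (gain_label j k t) = gain_label i k (s * t).
Proof.
move=> [nij njk nik] [n0j n0k nk nj] sH tH.
have stH : s * t \in gain_set by apply: (@groupM _ gain_group).
have lon := gain_label_on n0k njk tH.
have etK : gain j k (gain_label j k t) = t by apply: gain_labelK.
have [i0|ni] := eqVneq i o0; last first.
  have n0i : o0 != i by rewrite eq_sym.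
  have son := gain_label_on n0j nij sH.
  have pon := on_tp nij njk nik son lon.
  rewrite (gain_base n0i n0k nik pon).
  rewrite -(gain_mul (And3 n0i n0j n0k) (And3 nij njk nik) son lon) etK.
  by rewrite gain_labelK ?nj // /gain_label (negPf ni).
have son := gain_set_on sH; rewrite {1 3}/gain_label i0 eqxx permM -{2}etK gainE //.
have gon := gauge_on n0j son.
by rewrite /gain_fun son gauge1K // (on_tp n0j njk n0k gon lon).
Qed.

End GainGroup.

Lemma group_dowling (r4 : 3 < r) : dowling_geometry r g M.
Proof.
pose o0 := Ordinal (leq_trans (isT : 0 < 4) r4).
pose o1 := Ordinal (leq_trans (isT : 1 < 4) r4).
pose o2 := Ordinal (leq_trans (isT : 2 < 4) r4).
pose o3 := Ordinal (leq_trans (isT : 3 < 4) r4).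
have [n01 n02 n03] : [/\ o0 != o1, o0 != o2 & o0 != o3] by [].
have [n12 n13 n23] : [/\ o1 != o2, o1 != o3 & o2 != o3] by [].
pose H := gain_group n01 n02 n03 n12 n13 n23.
pose nu i j (s : subg_of H) := gain_label n01 i j (sgval s).
have cH : #|{: subg_of H}| = g.
  by rewrite card_sub -(card_gain_group n01 n02 n03 n12 n13 n23).
have gt0 (i j : 'I_r) : i < j -> [/\ o0 != j, i != j & j != o1 \/ i = o0].
  move=> lt; split; [|by rewrite neq_ltn lt|].
    by rewrite neq_ltn /= (leq_ltn_trans _ lt).
  have [->|ni] := eqVneq i o0; [by right|left].
  rewrite neq_ltn; apply/orP; right; apply: leq_ltn_trans lt.
  by rewrite lt0n.
have nu_on i j s : i < j -> on i j (nu i j s).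
  by move=> /gt0[n0j nij _]; apply: (gain_label_on n02 n12 n0j nij); apply: subgP.
have nu_inj i j : i < j -> injective (nu i j).
  move=> /gt0[n0j nij hj] s t e; apply: val_inj.
  by apply: (gain_label_inj n02 n12 n0j nij hj _ _ e); apply: subgP.
have lab_inj := label_inj nu_on nu_inj.
pose Q := pullback M lab_inj; have lab_bij := label_bij cH nu_on nu_inj.
left; exists (subg_of H), Q; split=> //; last exact: pullback_iso.
have vertP (i j : 'I_r) x : i < j -> on i j x -> col M (vert i) (vert j) x.
  move=> lt /eqP ex; have ne : i != j by rewrite neq_ltn lt.
  apply: (col_rk (flat_cflat [set i; j])); rewrite ?rk_cflat ?cards2 ?ne //.
  - by rewrite inE supp_vert sub1set set21.
  - by rewrite inE supp_vert sub1set set22.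
  by rewrite inE ex.
apply: dowling_flats.
- exact: simple_pullback.
- by rewrite mrank_pullback // /mrank -cflatT rk_cflat cardsT card_ord.
- move=> i j c lt; rewrite (pt_lt c lt) col_pullback.
  exact: vertP (nu_on i j c lt).
move=> i j k a b ltij ltjk; have ltik := ltn_trans ltij ltjk.
rewrite (pt_lt _ ltij) (pt_lt _ ltjk) (pt_lt _ ltik) col_pullback !label_pt_a.
have [n0j nij nj1] := gt0 _ _ ltij; have [n0k njk nk1] := gt0 _ _ ltjk.
have nik : i != k by rewrite neq_ltn ltik.
have -> : nu i k (a * b)%g = tp (nu i j a) (nu j k b).
  apply/esym; apply: (gain_label_mul n02 n03 n12 n13 n23 (And3 nij njk nik)); rewrite ?subgP //.
  split=> //.
    by case: nk1 => // ej; rewrite ej eqxx in n0j.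
  by case: nj1 => // -> /eqP.
by apply: col_tp; apply: on_adj (nu_on _ _ _ ltij) (nu_on _ _ _ ltjk).
Qed.

End Extremal.
End Frame.

(** * Rank three: the quasigroup *)

Lemma quasigroup_dowling (g : nat) (hg : 2 <= g) (E : finType) (M : matroid E)
    (sM : simple_matroid M) (hcard : #|E| = 3 + g * 'C(3, 2))
    (supp : E -> {set 'I_3})
    (cflat_large : forall T, large_rk g M (cflat supp T) #|T|)
    (extremal : #|three_point_lines M| = 'C(3, 3) * g ^ 2) :
  dowling_geometry 3 g M.
Proof.
pose o1 := ord3_1; pose o2 := ord3_2; pose o3 := ord3_3.
have [n12 n23 n13] : [/\ o1 != o2, o2 != o3 & o1 != o3] by [].
have [n21 n32 n31] : [/\ o2 != o1, o3 != o2 & o3 != o1] by [].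
have [nu [nu_on nu_inj]] := fiber_labelling hg hcard cflat_large.
pose on := on supp; pose adj := adj supp; pose tp := tp M.
have onC i j x : on i j x = on j i x by exact: onC.
have on_adj i j k x y : i != j -> j != k -> i != k -> on i j x -> on j k y -> adj x y.
  exact: on_adj.
have on_tp i j k x y : i != j -> j != k -> i != k -> on i j x -> on j k y -> on i k (tp x y).
  exact: (on_tp hg sM hcard cflat_large extremal).
have tpP x y : adj x y -> cl M [set x; y] = [set x; y; tp x y].
  by case/(tpP hg sM hcard cflat_large extremal).
have tpK x y : adj x y -> tp x (tp x y) = y.
  exact: (tpK hg sM hcard cflat_large extremal).
have tpKr x y : adj x y -> tp (tp x y) y = x.
  exact: (tpKr hg sM hcard cflat_large extremal).
have nu_surj (i j : 'I_3) x : i < j -> on i j x -> exists a, x = nu i j a.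
  exact: (nu_surj hg hcard cflat_large (card_ord g) nu_on nu_inj).
pose f := label cflat_large nu.
have f_inj : injective f by apply: label_inj.
have f_bij : bijective f by exact: (label_bij hg hcard cflat_large (card_ord g) nu_on nu_inj).
have f_large T : f @: large_flat _ T = cflat supp T.
  exact: (label_large_flat hg hcard cflat_large (card_ord g) nu_on nu_inj).
have tri_on a b : [/\ on o1 o2 (nu o1 o2 a), on o2 o3 (nu o2 o3 b) & on o1 o3 (nu o1 o3 b)].
  by split; apply: nu_on.
(* The label of the third point; [opE] shows that the default is never taken. *)
pose op a b := odflt a [pick c | nu o1 o3 c == tp (nu o1 o2 a) (nu o2 o3 b)].
have opE a b : nu o1 o3 (op a b) = tp (nu o1 o2 a) (nu o2 o3 b).
  have [aon bon _] := tri_on a b.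
  have [c ec] := nu_surj o1 o3 _ isT (on_tp _ _ _ _ _ n12 n23 n13 aon bon).
  by rewrite /op; case: pickP => [d /eqP //|/(_ c)]; rewrite ec eqxx.
pose Q := pullback M f_inj.
right; split=> //; exists 'I_g, op, Q; split.
(* Division is again [tp]: the points over any two sides determine the one over the third. *)
- split=> [a b|a b].
    have [aon _ bon] := tri_on a b; rewrite onC in aon.
    have [x ex] := nu_surj o2 o3 _ isT (on_tp _ _ _ _ _ n21 n13 n23 aon bon).
    have axb := on_adj _ _ _ _ _ n21 n13 n23 aon bon.
    exists x; split=> [|x' e].
      by apply: (nu_inj o1 o3 isT); rewrite opE -ex tpK.
    apply: (nu_inj o2 o3 isT); rewrite -ex -e opE tpK //.
    have [aon' xon _] := tri_on a x'.
    exact: (on_adj _ _ _ _ _ n12 n23 n13 aon' xon).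
  have [_ aon _] := tri_on a a; have [_ _ bon] := tri_on b b.
  rewrite onC in aon.
  have [x ex] := nu_surj o1 o2 _ isT (on_tp _ _ _ _ _ n13 n32 n12 bon aon).
  have axb := on_adj _ _ _ _ _ n13 n32 n12 bon aon.
  exists x; split=> [|x' e].
    by apply: (nu_inj o1 o3 isT); rewrite opE -ex tpKr.
  apply: (nu_inj o1 o2 isT); rewrite -ex -e opE tpKr //.
  have [aon' xon _] := tri_on x' a.
  exact: (on_adj _ _ _ _ _ n12 n23 n13 aon' xon).
- by rewrite card_ord.
- split; first exact: simple_pullback.
    by rewrite mrank_pullback // /mrank -(cflatT supp) (rk_cflat cflat_large) cardsT card_ord.
  have tripleE a a' : f @: [set @pt_a 3 'I_g a ord3_1 ord3_2 isT;
      @pt_a 3 'I_g a' ord3_2 ord3_3 isT; @pt_a 3 'I_g (op a a') ord3_1 ord3_3 isT] =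
      cl M [set nu o1 o2 a; nu o2 o3 a'].
    have [aon bon _] := tri_on a a'.
    rewrite tpP; last exact: (on_adj _ _ _ _ _ n12 n23 n13 aon bon).
    by rewrite !imsetU !imset_set1 -opE.
  move=> L; rewrite line_pullback // -(card_imset L f_inj); split.
    case=> lL L3.
    have T3 : #|[set: 'I_3]| = 3 by rewrite cardsT card_ord.
    have c12 : #|[set o1; o2]| = 2 by rewrite cards2.
    have c23 : #|[set o2; o3]| = 2 by rewrite cards2.
    have n : [set o1; o2] != [set o2; o3] by apply/eqP=> /setP/(_ o1); rewrite !inE.
    have [[U /eqP/cards2P[i [j [ne ->]]] eL]|[x [y [ex ey eL]]]] :=
        line_ge3 hg sM hcard cflat_large lL L3 (subsetT _) T3 (subsetT _) (subsetT _) c12 c23 n.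
      left; wlog lt : i j ne eL / i < j => [hwlog|].
        have := ne; rewrite neq_ltn => /orP[]; first exact: hwlog.
        by apply: hwlog; rewrite 1?eq_sym // setUC.
      by exists i, j; split=> //; apply: (imset_inj f_inj); rewrite f_large.
    have [|a ea] := nu_surj o1 o2 x isT; first exact/eqP.
    have [|b eb] := nu_surj o2 o3 y isT; first exact/eqP.
    right; exists a, b; apply: (imset_inj f_inj).
    by rewrite tripleE eL ea eb.
  case=> [[i [j [lt ->]]]|[a [a' ->]]].
    have ij2 : #|[set i; j]| = 2 by rewrite cards2 neq_ltn lt.
    rewrite f_large (line_cflat cflat_large ij2) (card_cflat cflat_large) ij2 lsize_small.
    by split=> //; nlia.
  have [aon bon _] := tri_on a a'; have aab := on_adj _ _ _ _ _ n12 n23 n13 aon bon.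
  rewrite tripleE; have := adj_line hg sM hcard cflat_large extremal aab.
  by rewrite inE => /andP[-> /eqP->].
exact: pullback_iso.
Qed.

(** The whole ground set is a large flat of rank r, so the results on large flats apply to it, and
    its large hyperplanes are those of [M]. Each [cflat] is a meet of such hyperplanes. *)
Lemma large_hyperplanes_frame (g r : nat) (hg : 2 <= g) (hr : 3 <= r)
    (E : finType) (M : matroid E) (sM : simple_matroid M)
    (hrank : mrank M = r) (hcard : #|E| = r + g * 'C(r, 2))
    (hbound : forall F : {set E}, flat M F ->
       #|F| <= rk M F + g * 'C(rk M F, 2))
    (hgap : forall F : {set E}, flat M F -> 2 < rk M F < r -> ~~ large M g F ->
       #|F| <= rk M F + g * 'C(rk M F - 1, 2)) :
  #|large_hyperplanes M g| <= r /\
  (#|large_hyperplanes M g| = r -> exists supp : E -> {set 'I_r},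
     forall T, large_rk g M (cflat supp T) #|T|).
Proof.
have lT : large_rk g M setT r.
  by apply/large_rkP; split; [apply: flatT|rewrite cardsT|].
have eH : large_hyps g M setT = large_hyperplanes M g.
  apply/setP=> H; rewrite !inE subsetT /= /large_rk /hyperplane -/(mrank M) hrank.
  have -> : ((rk M H).+1 == r) = (rk M H == r.-1) by apply/eqP/eqP; lia.
  by rewrite /large; case: (flat M H); rewrite //= andbC.
split; first by rewrite -eH; apply: (card_large_hyps hg sM hbound hgap _ lT); rewrite hr leqnn.
move=> cH; pose Hs (i : 'I_r) := nth set0 (enum (large_hyperplanes M g)) i.
have Hs_inj : injective Hs.
  by move=> i j /eqP; rewrite nth_uniq ?enum_uniq -?cardE ?cH // => /eqP/val_inj.
have HsP i : Hs i \in large_hyperplanes M g.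
  by rewrite -mem_enum mem_nth // -cardE cH.
exists (fun x => [set i | x \notin Hs i]) => T.
have sT : Hs @: (~: T) \subset large_hyperplanes M g.
  by apply/subsetP=> _ /imsetP[i _ ->].
rewrite -eH in sT cH.
have := large_bigcap hg sM hbound hgap (leqnn r) lT (subxx _) cH sT.
rewrite setTI (card_imset _ Hs_inj).
have -> : r - #|~: T| = #|T| by have := cardsC T; rewrite card_ord; lia.
suff -> : \bigcap_(H in Hs @: (~: T)) H = cflat (fun x => [set i | x \notin Hs i]) T by [].
apply/setP=> x; rewrite inE; apply/bigcapP/subsetP => [xH i|sx _ /imsetP[i iT ->]].
  by rewrite inE; apply: contraR => iT; apply: xH; rewrite imset_f // inE.
by apply: contraLR iT => xi; rewrite inE negbK; apply: sx; rewrite inE.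
Qed.

Theorem theorem6p2 (g r : nat) (hg : 2 <= g) (hr : 3 <= r)
    (E : finType) (M : matroid E)
    (hsimple : simple_matroid M)
    (hrank : mrank M = r)
    (hcard : #|E| = r + g * 'C(r, 2))
    (hbound : forall F : {set E}, flat M F ->
       #|F| <= rk M F + g * 'C(rk M F, 2))
    (hgap : forall F : {set E}, flat M F -> 2 < rk M F < r -> ~~ large M g F ->
       #|F| <= rk M F + g * 'C(rk M F - 1, 2)) :
  [/\ #|large_hyperplanes M g| <= r,
      (#|large_hyperplanes M g| = r ->
        exists2 B : {set E}, basis M B &
          forall X : {set E}, X \subset B -> large M g (cl M X))
    & (#|large_hyperplanes M g| = r ->
        #|three_point_lines M| <= 'C(r, 3) * g ^ 2 /\
        (#|three_point_lines M| = 'C(r, 3) * g ^ 2 ->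
          dowling_geometry r g M))].
Proof.
have [le frame] := large_hyperplanes_frame hg hr hsimple hrank hcard hbound hgap.
split=> // /frame[supp cfl]; first exact: (frame_basis hsimple cfl).
split=> [|ext]; first exact: (card_three_point_lines hg hsimple hcard cfl).
have [r4|r3] := ltnP 3 r; first exact: (group_dowling hg hsimple hcard cfl ext r4).
have e : r = 3 by apply/eqP; rewrite eqn_leq r3.
clear -hg hsimple hcard cfl ext e; subst r.
exact: (quasigroup_dowling hg hsimple hcard cfl ext).
Qed.
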